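(* Fix $0<\varepsilon<\varepsilon_1<1$. There is a sequence $(\mathcal{A}_N)_{N\ge1}$ of algorithms, $\mathcal{A}_N$ an $N$-sample algorithm (depending only on $N,\varepsilon,\varepsilon_1$), such that for every fixed reservoir distribution $\mu$ with $\mu^*>\varepsilon$, letting $a_{i^*}$ be the output of $\mathcal{A}_N$ run on $\mu$, \[ \limsup_{N\to\infty}\frac{\big(-\log\mathbb{P}[p_{i^*}<\mu^*-\varepsilon_1]\big)\cdot\log^2N}{N}\ \ge\ c_{\mu^*,\mu^*-\varepsilon}. \]
   Context: Infinite-armed Bernoulli bandit: a reservoir distribution $\mu$ is any Borel probability measure on $[0,1]$; $\mu^*$ denotes its essential supremum (the maximum of its support). There are countably many arms $a_1,a_2,\dots$ whose means $p_1,p_2,\dots$ are drawn i.i.d. from $\mu$ (unknown to the algorithm). Each time arm $a_i$ is sampled it returns a reward in $\{0,1\}$ distributed as Bernoulli$(p_i)$, independently of all other rewards given the means. An algorithm, at each step, chooses (based on previously observed rewards and possibly internal randomness) an arm to sample, and at the end outputs an arm index $i^*$. An $N$-sample algorithm takes exactly $N$ samples almost surely and then outputs $i^*$. For $a,b\in[0,1]$, $c_{a,b}=\frac{(\arccos(1-2a)-\arccos(1-2b))^2}{2}$. *)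

(* Defs.v *)
From HB Require Import structures.
From mathcomp Require Import all_boot all_order all_algebra.
From mathcomp Require Import all_classical all_reals all_analysis.
From mathcomp Require Import ess_sup_inf.
Set Implicit Arguments. Unset Strict Implicit. Unset Printing Implicit Defensive.
Import Order.TTheory GRing.Theory Num.Theory.
Import numFieldNormedType.Exports.
Local Open Scope classical_set_scope.
Local Open Scope ring_scope.

(* A history: the list of (arm index, observed reward) pairs, oldest first. *)
Definition history := seq (nat * bool).

(* A (randomized) algorithm, in behavioural form: given the history it
   chooses a probability distribution on arm indices (the next arm to sample),
   and at the end a probability distribution on arm indices (the output i^* ). *)
Record algorithm (R : realType) := Algorithm {
  alg_next : history -> nat -> R ;
  alg_out  : history -> nat -> R }.

Definition is_distr (R : realType) (q : nat -> R) :=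
  (forall i, 0 <= q i) /\ (\sum_(0 <= i <oo) (q i)%:E)%E = 1%E.

Definition valid_algorithm (R : realType) (A : algorithm R) :=
  forall h : history, is_distr (alg_next A h) /\ is_distr (alg_out A h).

Definition reservoir (R : realType) (mu : probability R R) :=
  mu `[0%R, 1%R]%classic = 1%E.

(* mu^* : essential supremum of mu (= max of its support). *)
Definition mustar (R : realType) (mu : probability R R) : R :=
  fine (ess_sup mu (fun x : R => x%:E)).

(* finite map "arm index -> mean" of the arms already drawn from the reservoir *)
Fixpoint lookup (R : Type) (m : seq (nat * R)) (i : nat) : option R :=
  match m with
  | [::] => None
  | (j, x) :: m' => if i == j then Some x else lookup m' i
  end.

Section Run.
Context (R : realType) (mu : probability R R) (A : algorithm R) (thr : R).
Local Open Scope ereal_scope.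

Definition bad_prob (m : seq (nat * R)) (i : nat) : \bar R :=
  match lookup m i with
  | Some x => if (x < thr)%R then 1 else 0
  | None => mu [set x | (x < thr)%R]
  end.

(* Semantics of the interaction with i.i.d. reservoir means, with the mean of
   an arm drawn from mu (lazily) the first time it is touched.
   [run k h m] = probability that, with k samples still to take, current
   history h and known means m, the final output arm has mean < thr. *)
Fixpoint run (k : nat) (h : history) (m : seq (nat * R)) : \bar R :=
  match k with
  | 0%N => \sum_(0 <= i <oo) ((alg_out A h i)%:E * bad_prob m i)
  | k'.+1 =>
      \sum_(0 <= a <oo) ((alg_next A h a)%:E *
        match lookup m a with
        | Some x => x%:E * run k' (rcons h (a, true)) m
                    + (1 - x)%:E * run k' (rcons h (a, false)) m
        | None => \int[mu]_(x in `[0%R, 1%R]%classic)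
                    (x%:E * run k' (rcons h (a, true)) ((a, x) :: m)
                     + (1 - x)%:E * run k' (rcons h (a, false)) ((a, x) :: m))
        end)
  end.

End Run.

Definition prob_bad (R : realType) (mu : probability R R) (A : algorithm R)
  (N : nat) (thr : R) : \bar R := run mu A thr N [::] [::].

Definition neglog (R : realType) (p : \bar R) : \bar R :=
  if p == 0%E then +oo%E else (- ln (fine p))%:E.

Definition c_const (R : realType) (a b : R) : R :=
  (acos (1 - 2 * a) - acos (1 - 2 * b)) ^+ 2 / 2.

(* Main.v *)
Require Import Defs.
From HB Require Import structures.
From mathcomp Require Import all_boot all_order all_algebra.
From mathcomp Require Import all_classical all_reals all_analysis.
From mathcomp Require Import ess_sup_inf measurable_realfun.
From mathcomp Require Import ring lra zify.
Import Order.TTheory GRing.Theory Num.Theory.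
Import numFieldNormedType.Exports.
Local Open Scope classical_set_scope.
Local Open Scope ring_scope.

Set Implicit Arguments.
Unset Strict Implicit.
Unset Printing Implicit Defensive.

(* Only a limsup is asked for, so countably many parameters may be treated as
   known: the parameters used at [N] are decoded from the 2-adic valuation of
   [N], hence every choice is in force for infinitely many [N].

   The algorithm plays one arm at a time and outputs the arm it holds at the
   end. An arm is first screened on a constant number [n0] of samples; then it
   is sampled in blocks of length [b] of order [log^2 N], and dropped as soon
   as its mean over [J] blocks falls below a threshold which, in the coordinate
   [arccos (1 - 2 p)], decreases like [D * log J] with [D = Delta / (1 + log N)].

   If [T] is the time at which an arm is dropped and [E (e^(lam T); dropped)]
   is below 1, a renewal argument bounds the failure probability by
   [e^(- lam (N - o(N)))]. The key estimate is that, whatever the mean of the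
   arm, being dropped exactly after [J] blocks has probability at most about
   [e^(- b D^2 J / 2)]. It is a Chernoff bound for the statistic
   [C_J - sum_(l <= J) C_l / l], where [C_l] counts the successes in the first
   [l] blocks: its weights add up to 0, so the mean of the arm drops out, and
   their squares add up to less than [J]. *)

(** * Elementary inequalities *)

Lemma derive_ge0_le (R : realType) (f df : R -> R) (a b : R) : a <= b ->
  (forall x : R, is_derive x 1 f (df x)) ->
  (forall x, a <= x <= b -> 0 <= df x) -> f a <= f b.
Proof.
move=> ab fdf df0.
have cf : {within `[a, b], continuous f}.
  apply: continuous_subspaceT => x.
  apply: differentiable_continuous; apply/derivable1_diffP.
  by have := fdf x => -[].
have [c /[!in_itv]/= cab e] := MVT_segment ab (fun x _ => fdf x) cf.
by rewrite -subr_ge0 e mulr_ge0 ?df0// subr_ge0.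
Qed.

Lemma sinD_ge (R : realType) (s t : R) : 0 <= t -> sin s - t <= sin (s + t).
Proof.
move=> t0.
pose f : R -> R := sin + id.
have : f s <= f (s + t).
  have dh (x : R) : is_derive x 1 f (cos x + 1) by apply: is_derive_eq.
  apply: (derive_ge0_le _ dh); first by rewrite lerDl.
  by move=> x _; have := cos_geN1 x; lra.
by rewrite /f !fctE /=; lra.
Qed.

(** One-sided Taylor bound of order two: the difference of the sides, as a function of [x = s + t],
    has derivative [sin x - sin s + (x - s)], nonnegative by [sinD_ge]. It bounds from below how
    much the threshold drops between two blocks. *)
Lemma cosD_le (R : realType) (s t : R) : 0 <= t ->
  cos (s + t) <= cos s - sin s * t + t ^+ 2 / 2.
Proof.
move=> t0.
pose f : R -> R := - cos - (sin s) *: id + 2^-1 *: (id - cst s) ^+ 2.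
have : f s <= f (s + t).
  have dh (x : R) : is_derive x 1 f (sin x - sin s + (x - s)).
    have dB : is_derive x 1 (id - cst s : R -> R) (1 - 0) by exact: is_deriveB.
    have dX := is_deriveX 2 dB.
    have dc : is_derive x 1 (- cos : R -> R) (- - sin x) by exact: is_deriveN.
    have dZ : is_derive x 1 (sin s *: id : R -> R) (sin s *: 1) by exact: is_deriveZ.
    have df := is_deriveD (is_deriveB dc dZ) (is_deriveZ 2^-1 dX).
    rewrite /f; refine (@is_derive_eq _ _ _ _ _ _ _ _ df _).
    by rewrite /= /GRing.scale/= !fctE /=; lra.
  apply: (derive_ge0_le _ dh).
  - by rewrite lerDl.
  - move=> x /andP[sx _].
    have := @sinD_ge _ s (x - s); rewrite subr_ge0 => /(_ sx).
    by rewrite [s + _]addrC subrK; lra.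
by rewrite /f !fctE /GRing.scale/= /GRing.exp/=; lra.
Qed.

Lemma is_derive_expRN (R : realType) (x : R) :
  is_derive x 1 (expR \o -%R : R -> R) (- expR (- x)).
Proof. by apply: is_derive_eq; rewrite /GRing.scale/= mulrN1. Qed.

(** Multiplying by [expR (- v)] turns the claim into [1 <= g e v], with [e] the sign of [v]. In the
    derivative of [g e] all terms below order two cancel, so its sign is plain. *)
Lemma expR_le_cubic (R : realType) (v : R) : -1 <= v <= 1 ->
  expR v <= 1 + v + v ^+ 2 / 2 + `|v| ^+ 3.
Proof.
move=> /andP[v1 v2]; have dE := @is_derive_expRN R.
pose g (e : R) : R -> R :=
  (cst 1 + id + 2^-1 *: (id * id) + e *: (id * id * id)) * (expR \o -%R).
have dg e (x : R) : is_derive x 1 (g e)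
    (((1 + x + 2^-1 * (x * x) + e * (x * x * x)) * - expR (- x)
     + (1 + x + e * 3 * (x * x)) * expR (- x))).
  have d1 : is_derive x 1 (cst 1 + id : R -> R) (0 + 1) by exact: is_deriveD.
  have d2 : is_derive x 1 (id * id : R -> R) (x *: 1 + x *: 1) by exact: is_deriveM.
  have d3 := is_deriveM d2 (is_derive_id x 1).
  have dg := is_deriveM
    (is_deriveD (is_deriveD d1 (is_deriveZ 2^-1 d2)) (is_deriveZ e d3)) (dE x).
  rewrite /g; refine (@is_derive_eq _ _ _ _ _ _ _ _ dg _).
  by rewrite !fctE /GRing.scale/= /GRing.scale/=; lra.
have g0 e : g e 0 = 1 by rewrite /g !fctE /= /GRing.scale/= oppr0 expR0; lra.
have conclude e : 1 <= g e v ->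
    expR v <= 1 + v + v ^+ 2 / 2 + e * v ^+ 3.
  have E0 := expR_gt0 v.
  rewrite /g !fctE /= /GRing.scale/= expRN ler_pdivlMr// mul1r.
  by move/le_trans; apply; rewrite le_eqVlt; apply/orP; left; apply/eqP; ring.
have [v0|v0] := leP 0 v.
  rewrite ger0_norm// -[v ^+ 3]mul1r; apply: conclude.
  apply: le_trans (_ : g 1 0 <= _); first by rewrite g0.
  apply: (derive_ge0_le v0 (dg 1)) => x /andP[x0 xv].
  rewrite [X in 0 <= X](_ : _ = (5/2 - x) * (x * x) * expR (- x)); last by field.
  by rewrite !mulr_ge0 ?expR_ge0//; lra.
rewrite ltr0_norm//.
have -> : (- v) ^+ 3 = -1 * v ^+ 3 by ring.
apply: conclude; apply: le_trans (_ : g (-1) 0 <= _); first by rewrite g0.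
rewrite -lerN2.
have dNg (x : R) : is_derive x 1 (- g (-1)) (- (((1 + x + 2^-1 * (x * x) + -1 * (x * x * x)) * - expR (- x)
     + (1 + x + -1 * 3 * (x * x)) * expR (- x)))).
  exact: is_deriveN.
apply: (derive_ge0_le (ltW v0) dNg) => x /andP[xv x0].
rewrite [X in 0 <= X](_ : _ = (7/2 - x) * (x * x) * expR (- x)); last by field.
apply: mulr_ge0; last exact: expR_ge0.
by apply: mulr_ge0; [lra|rewrite -expr2 sqr_ge0].
Qed.

(** The quadratic term carries the exact variance [x * (1 - x)]; a bound of Hoeffding type would
    lose the sharp constant [c_const]. After centring, the linear terms cancel. *)
Lemma bernoulli_mgf_le (R : realType) (x c : R) : 0 <= x <= 1 ->
  x * expR c + (1 - x) <= expR (c * x + x * (1 - x) * c ^+ 2 / 2 + `|c| ^+ 3).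
Proof.
move=> /andP[x0 x1].
have -> : x * expR c + (1 - x) =
    expR (c * x) * (x * expR (c * (1 - x)) + (1 - x) * expR (- (c * x))).
  rewrite mulrDr mulrCA -expRD [expR (c * x) * (_ * _)]mulrCA -expRD.
  by rewrite subrr expR0 mulr1 -mulrDr [x + _]addrC subrK mulr1.
rewrite -addrA expRD ler_wpM2l ?expR_ge0//.
have y0 : 0 <= 1 - x by lra.
have [c1|c1] := leP `|c| 1; last first.
  (* For [|c| > 1] the cubic term alone dominates, since [c * y <= |c| <= |c| ^+ 3]. *)
  have hc y : `|y| <= 1 -> expR (c * y) <= expR (x * (1 - x) * c ^+ 2 / 2 + `|c| ^+ 3).
    move=> y1; rewrite ler_expR.
    apply: (@le_trans _ _ (`|c| ^+ 3)); last first.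
      rewrite lerDr; apply: divr_ge0 => //.
      by apply: mulr_ge0 (sqr_ge0 _); exact: mulr_ge0.
    apply: (le_trans (ler_norm _)); rewrite normrM.
    apply: (@le_trans _ _ `|c|); first by rewrite ler_piMr.
    by rewrite ler_eXnr// ltW.
  have -> : - (c * x) = c * (- x) by ring.
  set E := expR (_ + _).
  have -> : E = x * E + (1 - x) * E by ring.
  apply: lerD; rewrite ler_wpM2l//; apply: hc.
    by rewrite ger0_norm//; lra.
  by rewrite normrN ger0_norm.
apply: le_trans (expR_ge1Dx _).
have bnd y : `|y| <= 1 -> -1 <= c * y <= 1.
  move=> y1; rewrite -ler_norml normrM.
  by rewrite mulr_ile1.
have h1 := @expR_le_cubic _ (c * (1 - x)) (bnd _ _).
have h2 := @expR_le_cubic _ (- (c * x)) _.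
have {}h1 := h1 ltac:(by rewrite ger0_norm//; lra).
have {}h2 := h2 ltac:(by rewrite -mulrN; apply: bnd; rewrite normrN ger0_norm).
apply: le_trans (lerD (ler_wpM2l x0 h1) (ler_wpM2l y0 h2)) _.
rewrite normrN !normrM (ger0_norm x0) (ger0_norm y0).
set C := `|c|; have C0 : 0 <= C by rewrite normr_ge0.
rewrite -subr_ge0.
rewrite [X in 0 <= X](_ : _ = C ^+ 3 * (1 - x * (1 - x) * ((1 - x) ^+ 2 + x ^+ 2))); last by field.
rewrite mulr_ge0 ?exprn_ge0// subr_ge0.
have : x * (1 - x) <= 1 by rewrite mulr_ile1//; lra.
have : (1 - x) ^+ 2 + x ^+ 2 <= 1 by nra.
by move=> *; rewrite mulr_ile1// ?addr_ge0 ?sqr_ge0// mulr_ge0.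
Qed.

(** * Coin tossing *)

(** Expectation over [n] independent tosses of bias [x]. The recursion peels off the earliest toss,
    as [run] does, and involves no integral. *)
Fixpoint coin_mean (R : realType) (x : R) (n : nat) (f : seq bool -> R) : R :=
  if n is n'.+1 then
    x * coin_mean x n' (fun v => f (true :: v)) +
    (1 - x) * coin_mean x n' (fun v => f (false :: v))
  else f [::].

Section CoinMean.
Context (R : realType) (x : R) (x01 : 0 <= x <= 1).

Let x0 : 0 <= x. Proof. by case/andP: x01. Qed.
Let y0 : 0 <= 1 - x. Proof. by rewrite subr_ge0; case/andP: x01. Qed.

Lemma coin_mean_le n f g : (forall v, size v = n -> f v <= g v) ->
  coin_mean x n f <= coin_mean x n g.
Proof.
elim: n f g => [|n IH] f g fg /=; first exact: fg.
by apply: lerD; apply: ler_wpM2l => //; apply: IH => v nv; apply: fg => /=; rewrite nv.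
Qed.

Lemma eq_coin_mean n f g : (forall v, size v = n -> f v = g v) ->
  coin_mean x n f = coin_mean x n g.
Proof. by move=> fg; apply/eqP; rewrite eq_le !coin_mean_le// => v /fg->. Qed.

Lemma coin_meanZ n c f :
  coin_mean x n (fun v => c * f v) = c * coin_mean x n f.
Proof. by elim: n f => [|n IH] f //=; rewrite !IH; ring. Qed.

Lemma coin_meanD n f g :
  coin_mean x n (fun v => f v + g v) = coin_mean x n f + coin_mean x n g.
Proof. by elim: n f g => [|n IH] f g //=; rewrite !IH; ring. Qed.

Lemma coin_mean_sum n m (F : 'I_m -> seq bool -> R) :
  coin_mean x n (fun v => \sum_(j < m) F j v) = \sum_(j < m) coin_mean x n (F j).
Proof.
elim: n F => [|n IH] F //=.
by rewrite !IH !mulr_sumr -big_split.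
Qed.

Lemma coin_mean_cst n c : coin_mean x n (fun=> c) = c.
Proof. by elim: n => [|n IH] //=; rewrite !IH; ring. Qed.

Lemma coin_mean_ge0 n f : (forall v, 0 <= f v) -> 0 <= coin_mean x n f.
Proof. by move=> f0; rewrite -(coin_mean_cst n 0) coin_mean_le. Qed.

Lemma coin_mean_le1 n (P : pred (seq bool)) :
  coin_mean x n (fun v => (P v)%:R) <= 1.
Proof.
by rewrite -[leRHS](coin_mean_cst n) coin_mean_le// => v _; case: (P v); rewrite ?ler01.
Qed.

Lemma coin_mean_cat m n f g :
  coin_mean x (m + n) (fun v => f (take m v) * g (drop m v)) =
  coin_mean x m f * coin_mean x n g.
Proof.
elim: m f => [|m IH] f /=.
  by rewrite -coin_meanZ; apply: eq_coin_mean => v _; rewrite take0 drop0.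
rewrite (IH (fun v => f (true :: v))) (IH (fun v => f (false :: v))); ring.
Qed.

Lemma coin_mean_take m n f :
  coin_mean x (m + n) (fun v => f (take m v)) = coin_mean x m f.
Proof.
rewrite -[RHS]mulr1 -(coin_mean_cst n 1) -coin_mean_cat.
by apply: eq_coin_mean => v _; rewrite mulr1.
Qed.

Lemma coin_mean_expR n (c : nat -> R) :
  coin_mean x n (fun v => expR (\sum_(s < n) c s * (nth false v s)%:R)) =
  \prod_(s < n) (x * expR (c s) + (1 - x)).
Proof.
elim: n c => [|n IH] c /=; first by rewrite !big_ord0 expR0.
rewrite big_ord_recl -(IH (fun s => c s.+1)) [RHS]mulrDl -[_ * expR _ * _]mulrA.
congr (_ * _ + _ * _); rewrite -?coin_meanZ; apply: eq_coin_mean => v _.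
  by rewrite big_ord_recl /= mulr1 expRD.
by rewrite big_ord_recl /= mulr0 add0r.
Qed.

(** Markov's inequality for the exponential of a weighted sum. The weights may have either sign and
    already contain the tilt; if they add up to 0, the mean [x] survives only through the
    variance. *)
Lemma coin_chernoff n (c : nat -> R) (A : R) (P : pred (seq bool)) :
  (forall v, size v = n -> P v -> A <= \sum_(s < n) c s * (nth false v s)%:R) ->
  coin_mean x n (fun v => (P v)%:R) <=
  expR (x * \sum_(s < n) c s + x * (1 - x) / 2 * \sum_(s < n) c s ^+ 2
        + \sum_(s < n) `|c s| ^+ 3 - A).
Proof.
move=> PA; rewrite expRD mulrC.
apply: (@le_trans _ _ (expR (- A) *
    coin_mean x n (fun v => expR (\sum_(s < n) c s * (nth false v s)%:R)))).
  rewrite -coin_meanZ; apply: coin_mean_le => v nv.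
  rewrite -expRD; case Pv: (P v); last exact: expR_ge0.
  by rewrite -[leLHS]expR0 ler_expR addrC subr_ge0 PA.
rewrite ler_wpM2l ?expR_ge0// coin_mean_expR.
rewrite !mulr_sumr -!big_split expR_sum.
apply: ler_prod => s _; apply/andP; split.
  by rewrite addr_ge0// mulr_ge0// expR_ge0.
apply: (le_trans (bernoulli_mgf_le (c s) x01)).
by rewrite ler_expR le_eqVlt; apply/orP; left; apply/eqP; rewrite /=; field.
Qed.

Lemma count_sum_nth (v : seq bool) m : (m <= size v)%N ->
  (count id (take m v))%:R = \sum_(s < m) (nth false v s)%:R :> R.
Proof.
elim: v m => [|r v IH] [|m] //= mv; rewrite ?big_ord0//.
by rewrite big_ord_recl natrD IH.
Qed.

Lemma sum_ord_cst n (c : R) : \sum_(s < n) c = n%:R * c.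
Proof. by rewrite sumr_const card_ord mulr_natl. Qed.

(** Constant weight [- (g / 2)]. The rate 1/4 is not sharp; these tails only serve where any
    constant rate suffices. *)
Lemma coin_tail_le n (t g : R) : 0 <= g <= 1 -> t + g <= x ->
  coin_mean x n (fun v => ((count id v)%:R < t * n%:R)%R%:R) <=
  expR (- (n%:R * g ^+ 2 / 4)).
Proof.
move=> /andP[g0 g1] tx.
apply: le_trans (@coin_chernoff n (fun=> - (g / 2)) (- (g / 2) * (t * n%:R)) _ _) _.
  move=> v nv lt; rewrite -mulr_sumr -count_sum_nth ?nv// -nv take_size nv.
  by rewrite !mulNr lerN2 ler_wpM2l ?divr_ge0// ltW.
rewrite ler_expR !sum_ord_cst normrN ger0_norm ?divr_ge0//.
set N := n%:R; have N0 : 0 <= N by rewrite /N.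
rewrite -subr_ge0 [X in 0 <= X](_ : _ = N * (g / 2 * (x - t - g) + g ^+ 2 / 4 *
  (1 - x * (1 - x) / 2 - g / 2))); last by field.
have xx : x * (1 - x) <= 1 / 2 by nra.
apply: mulr_ge0 => //; apply: addr_ge0.
  by apply: mulr_ge0; [rewrite divr_ge0|lra].
by apply: mulr_ge0; [rewrite divr_ge0// sqr_ge0|lra].
Qed.

Lemma coin_tail_ge n (t g : R) : 0 <= g <= 1 -> x + g <= t ->
  coin_mean x n (fun v => (t * n%:R <= (count id v)%:R)%R%:R) <=
  expR (- (n%:R * g ^+ 2 / 4)).
Proof.
move=> /andP[g0 g1] tx.
apply: le_trans (@coin_chernoff n (fun=> (g / 2)) ((g / 2) * (t * n%:R)) _ _) _.
  move=> v nv lt; rewrite -mulr_sumr -count_sum_nth ?nv// -nv take_size nv.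
  by rewrite ler_wpM2l ?divr_ge0.
rewrite ler_expR !sum_ord_cst ger0_norm ?divr_ge0//.
set N := n%:R; have N0 : 0 <= N by rewrite /N.
rewrite -subr_ge0 [X in 0 <= X](_ : _ = N * (g / 2 * (t - x - g) + g ^+ 2 / 4 *
  (1 - x * (1 - x) / 2 - g / 2))); last by field.
have xx : x * (1 - x) <= 1 / 2 by nra.
apply: mulr_ge0 => //; apply: addr_ge0.
  by apply: mulr_ge0; [rewrite divr_ge0|lra].
by apply: mulr_ge0; [rewrite divr_ge0// sqr_ge0|lra].
Qed.

End CoinMean.

(** * Harmonic weights and their moments *)

Section HarmonicTails.
Context (R : realType).

(* The Chernoff weight of block [i] (counted from 0) after [j] blocks is
   [1 - htail j i]. *)
Definition htail (j i : nat) : R := \sum_(l < j | (i <= l)%N) l.+1%:R^-1.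

Lemma htail_ge0 j i : 0 <= htail j i.
Proof. by apply: sumr_ge0 => l _; rewrite invr_ge0. Qed.

Lemma htailS j i : (i <= j)%N -> htail j.+1 i = htail j i + j.+1%:R^-1.
Proof.
by move=> ij; rewrite /htail big_mkcond big_ord_recr /= ij -big_mkcond.
Qed.

Lemma htail_diag j : htail j j = 0.
Proof. by apply: big1 => l /leq_ltn_trans/(_ (ltn_ord l)); rewrite ltnn. Qed.

Lemma sum_htailS (F : R -> R) j :
  \sum_(i < j.+1) F (htail j.+1 i) =
  \sum_(i < j) F (htail j i + j.+1%:R^-1) + F j.+1%:R^-1.
Proof.
rewrite big_ord_recr /= htailS// htail_diag add0r; congr (_ + _).
by apply: eq_bigr => i _; rewrite htailS// ltnW.
Qed.

(** [htail j i] is close to [log (j / i)], which for uniform [i] behaves like a standard exponential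
    variable: hence the moments 1, 2 and 6 here and in the next two lemmas. The first one makes the
    weights [1 - htail j i] add up to 0. *)
Lemma sum_htail j : \sum_(i < j) htail j i = j%:R.
Proof.
elim: j => [|j IH]; first by rewrite big_ord0.
rewrite (sum_htailS id) big_split /= IH sum_ord_cst.
by field; rewrite addrC natr1 pnatr_eq0.
Qed.

Lemma sum_htail2 j : \sum_(i < j) htail j i ^+ 2 <= 2 * j%:R.
Proof.
elim: j => [|j IH]; first by rewrite big_ord0 mulr0.
rewrite (sum_htailS (fun a => a ^+ 2)).
set u := j.+1%:R^-1.
have eX y : (y + u) ^+ 2 = y ^+ 2 + (2 * u) * y + u ^+ 2 by ring.
under eq_bigr => i _ do rewrite eX.
rewrite !big_split /= sum_ord_cst -!mulr_sumr sum_htail.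
have e : j%:R = u^-1 - 1 :> R by rewrite /u invrK -natr1; ring.
have u0 : 0 < u by rewrite invr_gt0.
have u1 : u <= 1 by rewrite invf_le1// ler1n.
have -> : j.+1%:R = u^-1 :> R by rewrite /u invrK.
move: IH; rewrite e => IH.
apply: le_trans (lerD (lerD (lerD IH (lexx _)) (lexx _)) (lexx _)) _.
rewrite -subr_ge0 [X in 0 <= X](_ : _ = u); first exact: ltW.
by field; rewrite gt_eqF.
Qed.

Lemma sum_htail3 j : \sum_(i < j) htail j i ^+ 3 <= 6 * j%:R.
Proof.
elim: j => [|j IH]; first by rewrite big_ord0 mulr0.
rewrite (sum_htailS (fun a => a ^+ 3)).
set u := j.+1%:R^-1.
have eX y : (y + u) ^+ 3 =
    y ^+ 3 + (3 * u) * y ^+ 2 + (3 * u ^+ 2) * y + u ^+ 3 by ring.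
under eq_bigr => i _ do rewrite eX.
rewrite !big_split /= sum_ord_cst -!mulr_sumr sum_htail.
have e : j%:R = u^-1 - 1 :> R by rewrite /u invrK -natr1; ring.
have u0 : 0 < u by rewrite invr_gt0.
have u1 : u <= 1 by rewrite invf_le1// ler1n.
have h2 := sum_htail2 j.
have u3 : 0 <= 3 * u by rewrite mulr_ge0// ltW.
have -> : j.+1%:R = u^-1 :> R by rewrite /u invrK.
move: IH h2; rewrite e => IH h2.
apply: le_trans (lerD (lerD (lerD (lerD IH (ler_wpM2l u3 h2)) (lexx _)) (lexx _)) (lexx _)) _.
rewrite -subr_ge0 [X in 0 <= X](_ : _ = u * (3 + 2 * u)); first by apply: mulr_ge0; lra.
by field; rewrite gt_eqF.
Qed.

Lemma sum_block (F : nat -> R) (b j : nat) : (0 < b)%N ->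
  \sum_(s < j * b) F (s %/ b)%N = b%:R * \sum_(i < j) F i.
Proof.
move=> b0; elim: j => [|j IH]; first by rewrite mul0n !big_ord0 mulr0.
rewrite mulSnr big_split_ord /= IH big_ord_recr mulrDr /=; congr (_ + _).
rewrite mulr_natl -[X in _ *+ X]card_ord -sumr_const; apply: eq_bigr => s _.
by rewrite divnMDl// divn_small// addn0.
Qed.

(** Exchange of summation: it identifies the weighted sum of single rewards with the sum of the
    running counts [C_l / l]. *)
Lemma sum_htail_block (v : nat -> R) (b j : nat) : (0 < b)%N ->
  \sum_(s < j * b) htail j (s %/ b)%N * v s =
  \sum_(l < j) l.+1%:R^-1 * \sum_(s < l.+1 * b) v s.
Proof.
move=> b0.
under eq_bigr => s _ do rewrite mulr_suml.
rewrite (exchange_big_dep xpredT)//=; apply: eq_bigr => l _.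
rewrite -mulr_sumr (big_ord_widen (j * b)) ?leq_mul2r ?ltn_ord ?orbT//.
by congr (_ * _); apply: eq_bigl => s; rewrite -ltnS ltn_divLR.
Qed.

End HarmonicTails.

(** * Crossing a slowly decreasing threshold *)

Definition crosses (R : realType) (b : nat) (th : nat -> R) (j : nat)
    (v : seq bool) : bool :=
  all (fun l => th l.+1 * (l.+1 * b)%:R <= (count id (take (l.+1 * b) v))%:R)
    (iota 0 j) &&
  ((count id (take (j.+1 * b) v))%:R < th j.+1 * (j.+1 * b)%:R).

(* The harmonic number [htail J.-1 0] stands for [log J]; with it the increments
   of the threshold sum up exactly. *)
Definition threshold (R : realType) (phi D : R) (J : nat) : R :=
  (1 - cos (phi - D * htail R J.-1 0)) / 2.

Section Crossing.
Context (R : realType) (x : R) (x01 : 0 <= x <= 1) (b : nat) (b0 : (0 < b)%N).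

(** The Chernoff statistic is [tau] times the sum of [C_l / l] minus the last count. A crossing
    forces every earlier count up and the last one down, so the threshold gaps bound it from
    below. *)
Lemma coin_crossing_le (th : nat -> R) (j : nat) (tau : R) : 0 <= tau ->
  coin_mean x (j.+1 * b) (fun v => (crosses b th j v)%:R) <=
  expR (b%:R * (x * (1 - x) * tau ^+ 2 / 2 * j.+1%:R + 7 * tau ^+ 3 * j.+1%:R
                - tau * \sum_(l < j) (th l.+1 - th j.+1))).
Proof.
move=> tau0; pose a := htail R j.+1.
pose c s := tau * (a (s %/ b)%N - 1).
have B0 : 0 <= b%:R :> R by [].
apply: le_trans (@coin_chernoff R x x01 _ c
  (b%:R * (tau * \sum_(l < j) (th l.+1 - th j.+1))) _ _) _.
  move=> v nv /andP[/allP all_ge lastlt].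
  rewrite /c; under [leRHS]eq_bigr => s _ do rewrite -mulrA mulrBl mul1r.
  rewrite -mulr_sumr mulrCA ler_wpM2l// [leRHS]sumrB.
  have -> := sum_htail_block (fun s => (nth false v s)%:R : R) j.+1 b0.
  (* The last count occurs twice, with total coefficient [1 / (j + 1) - 1 <= 0]; this is why an
     upper bound on it is the right information. *)
  rewrite big_ord_recr /=.
  have cnt l : (l <= j)%N -> \sum_(s < l.+1 * b) (nth false v s)%:R =
      (count id (take (l.+1 * b) v))%:R :> R.
    by move=> lj; rewrite count_sum_nth// nv leq_mul2r ltnS lj orbT.
  rewrite cnt// -addrA.
  rewrite -[X in _ <= _ + X]opprK opprB.
  rewrite sumrB mulrBr; apply: lerB; last first.
    rewrite sum_ord_cst.
    have J0 : (j.+1%:R : R) != 0 by rewrite pnatr_eq0.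
    rewrite -[X in X - _]mul1r -mulrBl.
    have -> : 1 - j.+1%:R^-1 = j%:R / j.+1%:R :> R.
      by rewrite -{2}natr1 in J0 *; field.
    apply: le_trans (ler_wpM2l _ (ltW lastlt)) _; first by rewrite divr_ge0.
    rewrite natrM le_eqVlt; apply/orP; left; apply/eqP.
    by field; rewrite addrC natr1.
  rewrite mulr_sumr; apply: ler_sum => l _.
  rewrite cnt; last by rewrite ltnW.
  rewrite mulrC ler_pdivlMl// mulrC.
  have := all_ge l; rewrite mem_iota /= add0n ltn_ord => /(_ isT).
  by rewrite natrM; apply: le_trans; rewrite le_eqVlt; apply/orP; left; apply/eqP; ring.
rewrite ler_expR.
rewrite (sum_block (fun i => tau * (a i - 1)))// (sum_block (fun i => (tau * (a i - 1)) ^+ 2))//.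
rewrite (sum_block (fun i => `|tau * (a i - 1)| ^+ 3))//.
have e1 : \sum_(i < j.+1) tau * (a i - 1) = 0.
  by rewrite -mulr_sumr sumrB sum_htail sumr_const card_ord subrr mulr0.
(* Expanding the square, the moments give at most 1 - 2 + 2 = 1 per block. *)
have e2 : \sum_(i < j.+1) (tau * (a i - 1)) ^+ 2 <= tau ^+ 2 * j.+1%:R.
  under eq_bigr => i _ do rewrite exprMn.
  rewrite -mulr_sumr ler_wpM2l ?sqr_ge0//.
  under eq_bigr => i _ do rewrite sqrrB mulr1 expr1n.
  rewrite big_split sumrB /= sumr_const card_ord sumrMnl sum_htail.
  by have := sum_htail2 R j.+1; rewrite -/a; lra.
(* 7 = 1 + 6, from [|a - 1| ^+ 3 <= 1 + a ^+ 3] for [a >= 0] and the third moment. *)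
have e3 : \sum_(i < j.+1) `|tau * (a i - 1)| ^+ 3 <= 7 * tau ^+ 3 * j.+1%:R.
  under eq_bigr => i _ do rewrite normrM exprMn ger0_norm//.
  rewrite -mulr_sumr (_ : 7 * _ * _ = tau ^+ 3 * (7 * j.+1%:R)); last by ring.
  rewrite ler_wpM2l ?exprn_ge0//.
  apply: (@le_trans _ _ (\sum_(i < j.+1) (1 + a i ^+ 3))).
    apply: ler_sum => i _.
    have ai0 : 0 <= a i by exact: htail_ge0.
    have [ai1|ai1] := leP 1 (a i).
      rewrite ger0_norm ?subr_ge0//.
      apply: (@le_trans _ _ (a i ^+ 3)); last by rewrite lerDr.
      by rewrite lerXn2r ?nnegrE ?subr_ge0// lerBlDr lerDl.
    rewrite ltr0_norm ?subr_lt0//.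
    apply: (@le_trans _ _ 1); last by rewrite lerDl exprn_ge0.
    by rewrite exprn_ile1//; lra.
  rewrite big_split /= sumr_const card_ord.
  by have := sum_htail3 R j.+1; rewrite -/a; lra.
rewrite e1 !mulr0 add0r [leRHS]mulrBr lerD2r [leRHS]mulrDr.
case/andP: (x01) => x0 x1.
have xx0 : 0 <= x * (1 - x) / 2 by rewrite divr_ge0// mulr_ge0// subr_ge0.
apply: lerD; last by rewrite ler_wpM2l.
apply: le_trans (ler_wpM2l xx0 (ler_wpM2l B0 e2)) _.
by rewrite le_eqVlt; apply/orP; left; apply/eqP; field.
Qed.

End Crossing.

Section Threshold.
Context (R : realType) (phi D : R).
Local Notation th := (threshold phi D).

Lemma htail_sub j l : (l <= j)%N -> htail R j 0 = htail R l 0 + htail R j l.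
Proof.
move=> /subnKC <-; elim: (j - l)%N => [|k IH]; first by rewrite addn0 htail_diag addr0.
by rewrite addnS !htailS ?leq_addr// IH addrA.
Qed.

(** The phases at blocks [l.+1] and [j.+1] differ by [D * htail R j l]. By [sum_htail] these
    differences add up to exactly [j * D], and [sum_htail2] controls the curvature error. *)
Lemma sum_threshold_ge j : 0 <= D ->
  j%:R * D * (sin (phi - D * htail R j 0) / 2 - D / 2) <=
  \sum_(l < j) (th l.+1 - th j.+1).
Proof.
move=> D0; set p := phi - _.
apply: (@le_trans _ _ (\sum_(l < j) (sin p / 2 * D * htail R j l
                       - D ^+ 2 / 4 * htail R j l ^+ 2))); last first.
  apply: ler_sum => l _; rewrite /threshold /=.
  have := @cosD_le R p (D * htail R j l).
  rewrite mulr_ge0 ?htail_ge0// => /(_ isT).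
  have -> : p + D * htail R j l = phi - D * htail R l 0.
    by rewrite /p (@htail_sub j l) ?(ltnW (ltn_ord l))//; ring.
  by rewrite -/p; lra.
rewrite sumrB -!mulr_sumr sum_htail.
have := ler_wpM2l (_ : 0 <= D ^+ 2 / 4) (sum_htail2 R j).
rewrite divr_ge0 ?sqr_ge0// => /(_ isT).
by lra.
Qed.

Lemma threshold_le i j : 0 <= D -> phi <= pi -> (0 < i)%N -> (i <= j)%N ->
  0 <= phi - D * htail R j.-1 0 -> th j <= th i.
Proof.
move=> D0 ppi i0 ij p0; rewrite /threshold.
have ij' : (i.-1 <= j.-1)%N by lia.
have h := htail_sub ij'; have hi := htail_ge0 R i.-1 0; have hij := htail_ge0 R j.-1 i.-1.
have le1 : D * htail R i.-1 0 <= D * htail R j.-1 0.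
  by rewrite ler_wpM2l// h lerDl.
have D1 : 0 <= D * htail R i.-1 0 by rewrite mulr_ge0.
rewrite ler_pM2r ?invr_gt0// lerD2l lerN2 leNgt ltr_cos ?in_itv/=; first by lra.
all: by apply/andP; split; lra.
Qed.

(** Half the sine of the phase is both the standard deviation of a toss at the threshold and the
    speed of the threshold per unit of phase. The two cancel in the exponent, which is the purpose
    of the arccos coordinate. *)
Lemma threshold_var J : th J * (1 - th J) = (sin (phi - D * htail R J.-1 0) / 2) ^+ 2.
Proof. by rewrite /threshold; have := sin2cos2 (phi - D * htail R J.-1 0); lra. Qed.

End Threshold.

(** Each block contributes about [- b D^2 / 2], whatever [x]. The additive term [b D^2] pays for
    having only [j] threshold gaps against [j.+1] blocks. *)
Lemma coin_crosses_threshold_le (R : realType) (phi D s d x : R) (b j : nat) :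
  0 <= x <= 1 -> (0 < b)%N -> 0 < s -> 0 < d <= 1 -> 0 <= D <= d * s ^+ 3 / 16 ->
  phi <= pi -> 0 <= phi - D * htail R j 0 ->
  s <= sin (phi - D * htail R j 0) / 2 ->
  coin_mean x (j.+1 * b) (fun v => (crosses b (threshold phi D) j v)%:R) <=
  expR (b%:R * D ^+ 2 - (1 - 2 * d) * (b%:R * D ^+ 2) * j.+1%:R / 2).
Proof.
move=> x01 b0 s0 /andP[d0 d1] /andP[D0 Ds] ppi p0 ssin.
set th := threshold phi D.
set sg := sin (phi - D * htail R j 0) / 2 in ssin *.
have sg0 : 0 < sg by exact: lt_le_trans ssin.
have sgh : sg <= 1 / 2 by rewrite /sg; have := sin_le1 (phi - D * htail R j 0); lra.
have vJ : th j.+1 * (1 - th j.+1) = sg ^+ 2 by rewrite threshold_var.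
have B0 : 0 <= b%:R :> R by [].
have J0 : 0 <= j%:R :> R by [].
case/andP: (x01) => x0 x1.
(* If the variance of the arm is much larger than [sg ^+ 2], its mean is far from
   the threshold and crossing is exponentially unlikely at a constant rate. *)
have [near|far] := leP (x * (1 - x)) ((1 + d) * sg ^+ 2).
  (* The tilt [D / sg] minimises [sg^2 tau^2 / 2 - tau D sg], with value [- D^2 / 2]. *)
  have tau0 : 0 <= D / sg by rewrite divr_ge0// ltW.
  apply: le_trans (coin_crossing_le x01 b0 th j tau0) _.
  rewrite ler_expR.
  have st := ler_wpM2l tau0 (sum_threshold_ge phi j D0).
  apply: (@le_trans _ _ (b%:R * (D ^+ 2 * (1 - (1 - 2 * d) * j.+1%:R / 2)))); last first.
    by rewrite le_eqVlt; apply/orP; left; apply/eqP; field.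
  rewrite ler_wpM2l//.
  apply: (@le_trans _ _ ((1 + d) * sg ^+ 2 * (D / sg) ^+ 2 / 2 * j.+1%:R
     + 7 * (D / sg) ^+ 3 * j.+1%:R - D / sg * (j%:R * D * (sg - D / 2)))).
    apply: lerB => //; rewrite lerD2r ler_wpM2r// ler_wpM2r// ler_wpM2r//.
    exact: sqr_ge0.
  (* In units of [D^2] per block, smallness of [D] limits the cubic error to [7 d / 16] and the
     curvature error to [d / 16]; with the [d / 2] lost on the variance they add up to [d]. *)
  have key : D / sg ^+ 3 <= d / 16.
    rewrite ler_pdivrMr ?exprn_gt0//; apply: (le_trans Ds).
    rewrite mulrAC ler_wpM2l ?divr_ge0// ?(ltW d0)//.
    by rewrite lerXn2r ?nnegrE// ltW.
  have key2 : D / (2 * sg) <= D / sg ^+ 3.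
    have sg3 : sg ^+ 3 <= 2 * sg.
      rewrite exprSr ler_wpM2r ?(ltW sg0)//; nra.
    apply: ler_wpM2l => //; rewrite lef_pV2 ?posrE//; first exact: mulr_gt0.
    exact: exprn_gt0.
  set q := D / sg ^+ 3 in key key2; set q2 := D / (2 * sg) in key2.
  rewrite [leLHS](_ : _ = D ^+ 2 * ((1 + d) / 2 * j.+1%:R + 7 * q * j.+1%:R
     - j%:R + q2 * j%:R)); last first.
    by rewrite /q /q2; field; rewrite gt_eqF.
  rewrite ler_wpM2l ?sqr_ge0//.
  have q20 : 0 <= q2 by rewrite divr_ge0// mulr_ge0// ltW.
  have -> : j.+1%:R = j%:R + 1 :> R by rewrite natr1.
  have h1 := ler_wpM2r J0 key.
  have h2 := ler_wpM2r J0 (le_trans key2 key).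
  have : 0 <= d * j%:R by rewrite mulr_ge0// ltW.
  by lra.
have rhs0 (y : R) : y <= b%:R * D ^+ 2 - b%:R * D ^+ 2 * j.+1%:R / 2 ->
    expR y <= expR (b%:R * D ^+ 2 - (1 - 2 * d) * (b%:R * D ^+ 2) * j.+1%:R / 2).
  move=> h; rewrite ler_expR; apply: (le_trans h).
  have : 0 <= d * (b%:R * D ^+ 2 * j.+1%:R).
    by rewrite mulr_ge0 ?(ltW d0)// !mulr_ge0 ?sqr_ge0.
  by lra.
pose g := d * s ^+ 2.
have g0 : 0 <= g by rewrite mulr_ge0 ?sqr_ge0// ltW.
have s2 : s <= 1 / 2 by exact: le_trans sgh.
have ss : s ^+ 2 <= 1 / 4 by nra.
have g1 : g <= 1 by rewrite mulr_ile1 ?sqr_ge0 ?(ltW d0)//; lra.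
have Dg : D <= g / 2.
  apply: (le_trans Ds); rewrite /g exprS; have := sqr_ge0 s; nra.
have DDg : D ^+ 2 <= g ^+ 2 / 4.
  rewrite [leRHS](_ : _ = (g / 2) ^+ 2); last by field.
  by rewrite lerXn2r ?nnegrE// divr_ge0.
(* The map [p * (1 - p)] is 1-Lipschitz on [[0, 1]], so a gap in variance is a gap in mean. *)
have farg : g <= `|x - th j.+1|.
  apply: (@le_trans _ _ (x * (1 - x) - th j.+1 * (1 - th j.+1))).
    rewrite vJ; apply: (@le_trans _ _ (d * sg ^+ 2)); last by lra.
    by rewrite /g ler_wpM2l ?(ltW d0)// lerXn2r ?nnegrE// ltW.
  apply: (le_trans (ler_norm _)).
  have -> : x * (1 - x) - th j.+1 * (1 - th j.+1) = (x - th j.+1) * (1 - x - th j.+1) by ring.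
  rewrite normrM ler_piMr//.
  have t0 : 0 <= th j.+1 by rewrite /th /threshold; have := cos_le1 (phi - D * htail R j.+1.-1 0); lra.
  have t1 : th j.+1 <= 1 by rewrite /th /threshold; have := cos_geN1 (phi - D * htail R j.+1.-1 0); lra.
  by rewrite ler_norml; apply/andP; split; lra.
have g01 : 0 <= g <= 1 by rewrite g0 g1.
move: farg; rewrite ler_normr => /orP[xhi|xlo].
  apply: (@le_trans _ _ (expR (- ((j.+1 * b)%:R * g ^+ 2 / 4)))); last first.
    apply: rhs0; rewrite natrM.
    have : b%:R * (j.+1%:R * D ^+ 2) <= b%:R * (j.+1%:R * (g ^+ 2 / 4)).
      by rewrite ler_wpM2l// ler_wpM2l.
    have : 0 <= b%:R * (j.+1%:R * D ^+ 2) by rewrite !mulr_ge0// sqr_ge0.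
    have : 0 <= b%:R * D ^+ 2 by rewrite !mulr_ge0// sqr_ge0.
    by lra.
  apply: le_trans (coin_tail_le x01 (j.+1 * b) (t := th j.+1) g01 _); last by lra.
  apply: coin_mean_le => // v nv; rewrite ler_nat /crosses.
  by case: (all _ _) => //=; rewrite -nv take_size.
(* For an arm far below the threshold, the unlikely event is to have passed the test one block
   earlier. With a single block there is no earlier test, but then the claimed bound is at least
   1. *)
destruct j as [|j].
  apply: le_trans (coin_mean_le1 x01 _ _) _; rewrite -[leLHS]expR0; apply: rhs0.
  have : 0 <= b%:R * D ^+ 2 by rewrite !mulr_ge0// sqr_ge0.
  by lra.
apply: (@le_trans _ _ (expR (- ((j.+1 * b)%:R * g ^+ 2 / 4)))); last first.
  apply: rhs0; rewrite natrM.
  have : b%:R * (j.+1%:R * D ^+ 2) <= b%:R * (j.+1%:R * (g ^+ 2 / 4)).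
    by rewrite ler_wpM2l// ler_wpM2l.
  have : 0 <= b%:R * (j.+1%:R * D ^+ 2) by rewrite !mulr_ge0// sqr_ge0.
  have : 0 <= b%:R * D ^+ 2 by rewrite !mulr_ge0// sqr_ge0.
  by rewrite -[j.+2%:R]natr1; lra.
have mono : th j.+2 <= th j.+1 by apply: threshold_le.
apply: le_trans (coin_tail_ge x01 (j.+1 * b) (t := th j.+1) g01 _); last by lra.
rewrite [X in coin_mean _ X](_ : _ = (j.+1 * b + b)%N); last by rewrite mulSnr.
rewrite -[leRHS](coin_mean_take x01 _ b); apply: coin_mean_le => // v nv.
rewrite ler_nat /crosses; case: allP => [h|//].
have -> : th j.+1 * (j.+1 * b)%:R <= (count id (take (j.+1 * b) v))%:R.
  by apply: h; rewrite mem_iota add0n leqnn.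
exact: leq_b1.
Qed.

(** * Playing one arm at a time *)

Lemma eseries_dirac (R : realType) (i : nat) (F : nat -> \bar R) :
  (\sum_(0 <= a <oo) ((a == i)%:R%:E * F a) = F i)%E.
Proof.
apply: cvg_lim => //; apply: cvg_near_cst; exists i.+1 => // n /= lin.
rewrite big_mkord (bigD1 (Ordinal lin))//= eqxx mul1e big1 ?adde0//.
by move=> a; rewrite -val_eqE /= => /negbTE->; rewrite mul0e.
Qed.

(* Unlike [ge0_le_integral], no measurability: [run] is not known to be
   measurable in the means. *)
Lemma ge0_integral_mono (d : measure_display) (T : measurableType d) (R : realType)
    (mu : {measure set T -> \bar R}) (D : set T) (f g : T -> \bar R) :
  (forall x, D x -> 0 <= f x)%E -> (forall x, D x -> f x <= g x)%E ->
  (\int[mu]_(x in D) f x <= \int[mu]_(x in D) g x)%E.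
Proof.
move=> f0 fg.
have g0 x : D x -> (0 <= g x)%E by move=> Dx; rewrite (le_trans (f0 _ Dx))// fg.
rewrite !ge0_integralE//; apply: le_ereal_sup => _ [h hf <-]; exists h => //.
move=> x; apply: (le_trans (hf x)); rewrite /patch; case: ifPn => // xD.
by apply: fg; rewrite -inE.
Qed.

Definition arm_step (rej : pred (seq bool)) (s : nat * seq bool) (ar : nat * bool) :=
  let w := rcons s.2 ar.2 in if rej w then (s.1.+1, [::]) else (s.1, w).

Definition arm_state (rej : pred (seq bool)) (h : history) :=
  foldl (arm_step rej) (0%N, [::]) h.

Definition sequential_alg (R : realType) (rej : pred (seq bool)) : algorithm R :=
  let current h a := (a == (arm_state rej h).1)%:R in Algorithm current current.

Lemma sequential_alg_valid (R : realType) (rej : pred (seq bool)) :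
  valid_algorithm (sequential_alg R rej).
Proof.
have dirac i : is_distr (fun a : nat => (a == i)%:R : R).
  split=> [a|]; first by case: (a == i).
  rewrite -[RHS](eseries_dirac i (fun=> 1%E)).
  by apply: eq_eseriesr => a _; rewrite mule1.
by move=> h; split; exact: dirac.
Qed.

Fixpoint kept (rej : pred (seq bool)) (w v : seq bool) : bool :=
  if v is r :: v' then ~~ rej (rcons w r) && kept rej (rcons w r) v' else true.

(** The variable [e^(lam T)] on the event that rejection occurs within [v], and 0 otherwise; [T]
    counts the samples after [w]. *)
Fixpoint rej_cost (R : realType) (lam : R) (rej : pred (seq bool)) (w v : seq bool) : R :=
  if v is r :: v' then
    expR lam * (if rej (rcons w r) then 1 else rej_cost lam rej (rcons w r) v')
  else 0.

Section Renewal.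
Context (R : realType) (mu : probability R R) (rej : pred (seq bool)).
Context (thr lam : R) (n1 N : nat) (lam0 : 0 <= lam).

Let decay (k : nat) : R := expR (- (lam * (k%:R - n1%:R))).

(** Bounds the failure probability with [k] samples left on an arm of mean [x] and record [w].
    Either the arm is kept to the end and is bad, or it is dropped after [T] samples, and a fresh
    start with [k - T] samples costs [decay k * e^(lam T)]. *)
Definition arm_bound (k : nat) (w : seq bool) (x : R) : R :=
  (x < thr)%R%:R * coin_mean x k (fun v => (kept rej w v)%:R)
  + expR (- (lam * (k%:R - n1%:R))) * coin_mean x k (rej_cost lam rej w).

Let A := sequential_alg R rej.

Lemma arm_boundS k w x : arm_bound k.+1 w x =
  x * (if rej (rcons w true) then decay k else arm_bound k (rcons w true) x) +
  (1 - x) * (if rej (rcons w false) then decay k else arm_bound k (rcons w false) x).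
Proof.
rewrite /arm_bound /=.
have -> : expR (- (lam * (k.+1%:R - n1%:R))) = decay k * expR (- lam).
  by rewrite /decay -expRD -natr1; congr expR; ring.
have E : expR (- lam) * expR lam = 1 by rewrite -expRD addrC subrr expR0.
have hH r : coin_mean x k (fun v => expR lam *
     (if rej (rcons w r) then 1 else rej_cost lam rej (rcons w r) v)) =
   expR lam * (if rej (rcons w r) then 1 else
      coin_mean x k (rej_cost lam rej (rcons w r))).
  by rewrite coin_meanZ; case: ifP => // _; rewrite coin_mean_cst.
have hS r : coin_mean x k (fun v => (~~ rej (rcons w r) && kept rej (rcons w r) v)%:R) =
   if rej (rcons w r) then 0 else coin_mean x k (fun v => (kept rej (rcons w r) v)%:R).
  by case: ifP => // _; rewrite coin_mean_cst.
rewrite !hH !hS -/(decay k).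
set c := (x < thr)%R%:R; set e1 := expR (- lam); set e2 := expR lam in E *.
have e S H : c * S + decay k * e1 * (x * (e2 * H.1) + (1 - x) * (e2 * H.2)) =
    c * S + decay k * (x * H.1 + (1 - x) * H.2).
  rewrite [in RHS](_ : decay k = decay k * (e1 * e2)); first by ring.
  by rewrite E mulr1.
have := e _ (_, _) => /= ->.
by case: (rej (rcons w true)); case: (rej (rcons w false)); ring.
Qed.

(** The renewal condition: averaged over a fresh mean, the bound for one arm reproduces the
    decay. *)
Context (fresh_le : forall k, (n1 <= k <= N)%N ->
  (\int[mu]_(x in `[0%R, 1%R]) (arm_bound k [::] x)%:E <= (decay k)%:E)%E).

Lemma run_step k h m a : a = (arm_state rej h).1 ->
  run mu A thr k.+1 h m =
  match lookup m a with
  | Some x => x%:E * run mu A thr k (rcons h (a, true)) m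
              + (1 - x)%:E * run mu A thr k (rcons h (a, false)) m
  | None => \int[mu]_(x in `[0%R, 1%R]%classic)
              (x%:E * run mu A thr k (rcons h (a, true)) ((a, x) :: m)
               + (1 - x)%:E * run mu A thr k (rcons h (a, false)) ((a, x) :: m))
  end%E.
Proof. by move=> ->; rewrite /= (eseries_dirac (arm_state rej h).1). Qed.

(** Induction on [k], with the invariant that arms after the current one have no mean yet. The
    bounds 0 and 1 are carried along: the former for monotonicity of the integral, the latter for
    small [k]. *)
Lemma run_bounds k h m i w : (k <= N)%N -> arm_state rej h = (i, w) ->
  (forall j, (i < j)%N -> lookup m j = None) ->
  (w = [::] -> lookup m i = None ->
    0 <= run mu A thr k h m <= 1 /\ run mu A thr k h m <= (decay k)%:E)%E /\
  (forall x, (0 <= x <= 1)%R -> lookup m i = Some x ->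
    0 <= run mu A thr k h m <= 1 /\ run mu A thr k h m <= (arm_bound k w x)%:E)%E.
Proof.
elim: k h m i w => [|k IH] h m i w kN hs hm.
  have thr1 : (mu [set x | (x < thr)%R] <= 1)%E.
    have -> : [set x | x < thr] = [set` `]-oo, thr[] by rewrite set_itvE.
    by apply: probability_le1; exact: measurable_itv.
  rewrite /= (eseries_dirac (arm_state rej h).1) hs /=; split.
    move=> _ mi; rewrite /bad_prob mi; split.
      by rewrite measure_ge0 thr1.
    apply: (@le_trans _ _ 1%E) => //.
    by rewrite lee_fin /decay -expR0 ler_expR sub0r mulrN opprK mulr_ge0.
  move=> x x01 mi; rewrite /bad_prob mi /arm_bound /= mulr0 addr0 mulr1.
  by case: (x < thr); rewrite ?lee_fin ?lexx ?ler01.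
have step x m' : 0 <= x <= 1 -> lookup m' i = Some x ->
    (forall j, (i < j)%N -> lookup m' j = None) ->
    (let v := x%:E * run mu A thr k (rcons h (i, true)) m'
              + (1 - x)%:E * run mu A thr k (rcons h (i, false)) m' in
     0 <= v <= 1 /\ v <= (arm_bound k.+1 w x)%:E)%E.
  move=> x01 mi mj; case/andP: (x01) => x0 x1.
  have y0 : 0 <= 1 - x by rewrite subr_ge0.
  have br r : (0 <= run mu A thr k (rcons h (i, r)) m' <= 1 /\
      run mu A thr k (rcons h (i, r)) m' <=
      (if rej (rcons w r) then decay k else arm_bound k (rcons w r) x)%:E)%E.
    have hs' : arm_state rej (rcons h (i, r)) =
        if rej (rcons w r) then (i.+1, [::]) else (i, rcons w r).
      by rewrite /arm_state foldl_rcons -/(arm_state rej h) hs.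
    move: hs'; case: ifP => rr hs'.
      have [+ _] := IH _ m' _ _ (ltnW kN) hs' (fun j hj => mj j (ltnW hj)).
      by apply => //; exact: mj.
    by have [_ +] := IH _ m' _ _ (ltnW kN) hs' mj; apply.
  have [/andP[a0 a1] aB] := br true; have [/andP[b0 b1] bB] := br false.
  split; last first.
    rewrite arm_boundS [leRHS]EFinD !EFinM.
    by apply: leeD; apply: lee_wpmul2l.
  apply/andP; split; first by rewrite adde_ge0// mule_ge0.
  apply: (@le_trans _ _ (x%:E * 1 + (1 - x)%:E * 1)%E).
    by apply: leeD; apply: lee_wpmul2l.
  by rewrite !mule1 -EFinD addrC subrK.
rewrite (@run_step k h m i) ?hs//; split.
  move=> w0 mi; rewrite mi.
  have stepx x : x \in `[0, 1] -> (let v :=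
      x%:E * run mu A thr k (rcons h (i, true)) ((i, x) :: m)
      + (1 - x)%:E * run mu A thr k (rcons h (i, false)) ((i, x) :: m) in
     0 <= v <= 1 /\ v <= (arm_bound k.+1 w x)%:E)%E.
    rewrite in_itv /= => x01; apply: step => //=; first by rewrite eqxx.
    by move=> j ij; rewrite gtn_eqF// hm.
  set I := (X in (0 <= X <= 1)%E).
  have I0 : (0 <= I)%E.
    by apply: integral_ge0 => x /= x01; have [/andP[]] := stepx x x01.
  have I1 : (I <= 1)%E.
    apply: (@le_trans _ _ (\int[mu]_(x in `[0%R, 1%R]) 1)%E).
      by apply: ge0_integral_mono => x /= x01; have [/andP[]] := stepx x x01.
    rewrite integral_cst ?mul1e ?probability_le1//; exact: measurable_itv.
  rewrite I0 I1; split=> //.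
  (* With fewer than [n1] samples left the decay bound is at least 1, and being a probability is
     enough. *)
  have [kn|kn] := leqP n1 k.+1.
    apply: le_trans (fresh_le _); last by rewrite kn.
    apply: ge0_integral_mono => x /= x01; have [/andP[]] := stepx x x01 => //.
    by rewrite w0.
  apply: (le_trans I1); rewrite lee_fin /decay -[leLHS]expR0 ler_expR -mulrN mulr_ge0//.
  by rewrite opprB subr_ge0 ler_nat ltnW.
move=> x x01 mi; rewrite mi; exact: step.
Qed.

Lemma prob_bad_le : (0 <= prob_bad mu A N thr <= (decay N)%:E)%E.
Proof.
have [+ _] := @run_bounds N [::] [::] 0 [::] (leqnn N) erefl (fun _ _ => erefl).
by case/(_ erefl erefl) => /andP[a0 _] aD; rewrite /prob_bad a0 aD.
Qed.

End Renewal.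

(** * Screening followed by block tests *)

Lemma kept_take (rej : pred (seq bool)) (w v : seq bool) (s : nat) :
  kept rej w v -> (0 < s <= size v)%N -> ~~ rej (w ++ take s v).
Proof.
elim: v w s => [|r v IH] w [|s] //= /andP[h1 h2]; rewrite ltnS => sv.
rewrite -cat_rcons; case: s sv => [|s] sv; first by rewrite take0 cats0.
exact: IH.
Qed.

Lemma rej_costP (R : realType) (lam : R) (rej : pred (seq bool)) (w v : seq bool) :
  rej_cost lam rej w v = 0 \/
  exists t, [/\ (t < size v)%N, rej_cost lam rej w v = expR (lam * t.+1%:R),
    rej (w ++ take t.+1 v) & kept rej w (take t v)].
Proof.
elim: v w => [|r v IH] w /=; first by left.
case: ifPn => wr.
  by right; exists 0%N; split; rewrite ?mulr1// take0 cats1.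
have [->|[t [tv -> h1 h2]]] := IH (rcons w r); first by left; rewrite mulr0.
right; exists t.+1; split => //=.
- by rewrite -expRD -[t.+2%:R]natr1; congr expR; ring.
- by rewrite -cat_rcons.
- by rewrite wr.
Qed.

(** The block tests discard the [n0] screening rewards, which makes the two stages independent.
    After [K] tests the arm is kept forever. *)
Definition rejects (R : realType) (n0 : nat) (thS : R) (b K : nat) (th : nat -> R)
    (w : seq bool) : bool :=
  (size w == n0) && ((count id w)%:R < thS * n0%:R) ||
  has (fun j => (size w == n0 + j.+1 * b)%N &&
         ((count id (drop n0 w))%:R < th j.+1 * (j.+1 * b)%:R)) (iota 0 K).

Section Rejects.
Context (R : realType) (n0 : nat) (thS : R) (b K : nat) (th : nat -> R).
Context (x lam : R) (x01 : 0 <= x <= 1) (n0_gt0 : (0 < n0)%N) (b0 : (0 < b)%N).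
Local Notation rej := (rejects n0 thS b K th).

Lemma kept_screen v : kept rej [::] v -> (n0 <= size v)%N ->
  thS * n0%:R <= (count id (take n0 v))%:R.
Proof.
move=> /kept_take + nv => /(_ n0); rewrite n0_gt0 nv => /(_ isT).
by rewrite cat0s negb_or => /andP[]; rewrite size_takel// eqxx /= -leNgt.
Qed.

Lemma kept_block v l : kept rej [::] v -> (l < K)%N -> (n0 + l.+1 * b <= size v)%N ->
  th l.+1 * (l.+1 * b)%:R <= (count id (take (l.+1 * b) (drop n0 v)))%:R.
Proof.
move=> /kept_take + lK nv => /(_ (n0 + l.+1 * b)%N).
rewrite nv addn_gt0 n0_gt0 => /(_ isT).
rewrite cat0s negb_or => /andP[_ /hasPn/(_ l)].
rewrite mem_iota add0n lK => /(_ isT).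
by rewrite size_takel// eqxx /= -leNgt take_drop addnC.
Qed.

Let scr v : bool := thS * n0%:R <= (count id v)%:R.

(** Rejection can only occur at time [n0] or [n0 + j.+1 * b]. In the latter case the arm has passed
    the screening and all earlier tests, which is the event [crosses]. *)
Lemma rej_cost_le v : (n0 + K * b <= size v)%N ->
  rej_cost lam rej [::] v <=
  expR (lam * n0%:R) * ((~~ scr (take n0 v))%:R +
   \sum_(j < K) expR (lam * (j.+1 * b)%:R) *
     ((scr (take n0 v))%:R * (crosses b th j (take (j.+1 * b) (drop n0 v)))%:R)).
Proof.
move=> nv.
have [->|[t [tv -> rt kt]]] := rej_costP lam rej [::] v.
  rewrite mulr_ge0 ?expR_ge0// addr_ge0//; apply: sumr_ge0 => j _.
  by rewrite mulr_ge0 ?expR_ge0// mulr_ge0.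
have {rt} [] := orP rt.
  rewrite cat0s size_takel// => /andP[/eqP tn].
  rewrite tn ltNge -/(scr (take n0 v)) => ->.
  rewrite ler_peMr ?expR_ge0// lerDl; apply: sumr_ge0 => j _.
  by rewrite mulr_ge0 ?expR_ge0// mulr_ge0.
case/hasP => j; rewrite mem_iota add0n cat0s size_takel// => jK /andP[/eqP tn lt].
rewrite tn natrD mulrDr expRD ler_wpM2l ?expR_ge0//.
rewrite (bigD1 (Ordinal jK))//=.
have n0t : (n0 <= t)%N by clear -tn b0; rewrite mulSn in tn; lia.
have stv : size (take t v) = t by rewrite size_takel// ltnW.
have -> : scr (take n0 v).
  rewrite /scr -[take n0 v](take_takel v n0t); apply: kept_screen => //.
  by rewrite stv.
have -> : crosses b th j (take (j.+1 * b) (drop n0 v)).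
  apply/andP; split; last first.
    by rewrite take_takel// take_drop addnC -tn.
  apply/allP => l; rewrite mem_iota add0n => lj.
  have lb : (l.+1 * b <= j.+1 * b)%N by rewrite leq_mul2r ltnS ltnW ?orbT.
  have lt' : (n0 + l.+1 * b <= t)%N.
    by rewrite -ltnS tn -addnS leq_add2l; nia.
  rewrite take_takel//.
  rewrite take_drop addnC -[take (n0 + _) v](take_takel v lt') -addnC -take_drop.
  by apply: kept_block => //; [exact: ltn_trans jK|rewrite stv].
rewrite !mulr1 addrA add0r lerDl; apply: sumr_ge0 => i _.
by rewrite mulr_ge0 ?expR_ge0// mulr_ge0.
Qed.

(** Independence of the stages yields the factor for passing the screening; it is what makes the
    later costs of a poor arm small. *)
Lemma mean_rej_cost_le k : (n0 + K * b <= k)%N ->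
  coin_mean x k (rej_cost lam rej [::]) <=
  expR (lam * n0%:R) * (coin_mean x n0 (fun v => (~~ scr v)%:R) +
   coin_mean x n0 (fun v => (scr v)%:R) *
   \sum_(j < K) expR (lam * (j.+1 * b)%:R) *
     coin_mean x (j.+1 * b) (fun v => (crosses b th j v)%:R)).
Proof.
move=> nk.
have /(coin_mean_le x01)/le_trans -> // : forall v, size v = k -> _ :=
  fun v nv => rej_cost_le (etrans (congr1 (leq _) nv) nk).
rewrite coin_meanZ ler_wpM2l ?expR_ge0//.
rewrite coin_meanD coin_mean_sum.
have n0k : (n0 <= k)%N by apply: leq_trans nk; exact: leq_addr.
rewrite -{1}(subnKC n0k) (coin_mean_take x01 _ _ (fun v => (~~ scr v)%:R)) lerD2l mulr_sumr.
apply: ler_sum => j _; rewrite coin_meanZ mulrCA ler_wpM2l ?expR_ge0//.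
have jb : (j.+1 * b <= k - n0)%N.
  by rewrite leq_subRL//; apply: leq_trans nk; rewrite leq_add2l leq_mul2r ltn_ord orbT.
rewrite -{1}(subnKC n0k) (coin_mean_cat x01 _ _ (fun v => (scr v)%:R)
  (fun v => (crosses b th j (take (j.+1 * b) v))%:R)).
by rewrite -{1}(subnKC jb) (coin_mean_take x01 _ _ (fun v => (crosses b th j v)%:R)).
Qed.

(** Only the last of the [K] tests is used; the screening rewards integrate to 1. *)
Lemma mean_kept_le k : (0 < K)%N -> (n0 + K * b <= k)%N ->
  coin_mean x k (fun v => (kept rej [::] v)%:R) <=
  coin_mean x (K * b) (fun v => (th K * (K * b)%:R <= (count id v)%:R)%R%:R).
Proof.
move=> K0 nk.
have n0k : (n0 <= k)%N by apply: leq_trans nk; exact: leq_addr.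
have Kb : (K * b <= k - n0)%N by rewrite leq_subRL.
rewrite -[leRHS](coin_mean_take x01 _ (k - n0 - K * b)) subnKC//.
rewrite -[leRHS]mul1r -[X in X * _](coin_mean_cst x n0) -(coin_mean_cat x01) subnKC//.
apply: coin_mean_le => // v nv; rewrite mul1r ler_nat.
case kv: (kept _ _ _) => //.
have := @kept_block v K.-1 kv; rewrite prednK// nv nk leqnn => -> //.
Qed.

End Rejects.

(** * The expected cost of a fresh arm *)

Lemma geometric_sum_le (R : realType) (q : R) (K : nat) : 0 <= q < 1 ->
  \sum_(j < K) q ^+ j.+1 <= q / (1 - q).
Proof.
move=> /andP[q0 q1]; have q1' : 0 < 1 - q by rewrite subr_gt0.
rewrite ler_pdivlMr//; suff -> : (\sum_(j < K) q ^+ j.+1) * (1 - q) = q - q ^+ K.+1.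
  by rewrite lerBlDr lerDl exprn_ge0.
elim: K => [|K IH]; first by rewrite big_ord0 mul0r expr1 subrr.
by rewrite big_ord_recr /= mulrDl IH [q ^+ K.+2]exprS; ring.
Qed.

(** The integrand is dominated by a combination of three indicators, so no measurability of [f] is
    assumed. The mass below [x0] is enlarged to that of the complement of [[y, +oo[]. *)
Lemma step_integral_le (R : realType) (mu : probability R R) (f : R -> R)
    (x0 y c1 c2 c3 : R) :
  x0 <= y -> 0 <= c1 -> 0 <= c2 -> 0 <= c3 ->
  (forall x, 0 <= x <= 1 -> 0 <= f x) ->
  (forall x, 0 <= x <= 1 -> x < x0 -> f x <= c1) ->
  (forall x, 0 <= x <= 1 -> x0 <= x < y -> f x <= c2) ->
  (forall x, 0 <= x <= 1 -> y <= x -> f x <= c3) ->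
  (\int[mu]_(x in `[0%R, 1%R]) (f x)%:E <=
   (c1 * (1 - fine (mu `[y, +oo[%classic)) + c2 * fine (mu `[x0, y[%classic)
    + c3 * fine (mu `[y, +oo[%classic))%:E)%E.
Proof.
move=> xy c10 c20 c30 f0 f1 f2 f3.
pose A1 := `]-oo, x0[%classic : set R.
pose A2 := `[x0, y[%classic : set R.
pose A3 := `[y, +oo[%classic : set R.
have mA1 : measurable A1 by exact: measurable_itv.
have mA2 : measurable A2 by exact: measurable_itv.
have mA3 : measurable A3 by exact: measurable_itv.
have mD : measurable (`[0%R, 1%R]%classic : set R) by exact: measurable_itv.
have mind (A D : set R) : measurable A ->
    measurable_fun D (EFin \o (\1_A : R -> R)).
  by move=> mA; apply/measurable_EFinP; exact: measurable_indic.
have ind1 (A : set R) x : A x -> \1_A x = 1 :> R.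
  by move=> Ax; rewrite indicE mem_set.
have ind0 c (A : set R) x : 0 <= c -> 0 <= c * \1_A x.
  by move=> c0; rewrite mulr_ge0.
apply: (@le_trans _ _ (\int[mu]_(x in `[0%R, 1%R])
    (c1%:E * (\1_A1 x)%:E + (c2%:E * (\1_A2 x)%:E + c3%:E * (\1_A3 x)%:E)))%E).
  apply: ge0_integral_mono => x /=; rewrite in_itv/= => x01; first by rewrite lee_fin f0.
  rewrite -!EFinM -!EFinD lee_fin.
  have [xx0|xx0] := ltP x x0.
    rewrite (ind1 A1) ?mulr1; last by rewrite /A1/= in_itv.
    by rewrite ler_wpDr ?f1// addr_ge0 ?ind0.
  have [xy'|xy'] := ltP x y.
    rewrite (ind1 A2) ?mulr1; last by rewrite /A2/= in_itv/= xx0.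
    by rewrite ler_wpDl ?ind0// ler_wpDr ?ind0// f2// xx0.
  rewrite (ind1 A3) ?mulr1; last by rewrite /A3/= in_itv/= andbT.
  by rewrite !ler_wpDl ?ind0// f3.
have cM (c : R) (A : set R) : 0 <= c -> measurable A ->
    (\int[mu]_(x in `[0%R, 1%R]) (c%:E * (\1_A x : R)%:E) <= c%:E * mu A)%E.
  move=> c0 mA.
  have -> : (\int[mu]_(x in `[0%R, 1%R]) (c%:E * (\1_A x : R)%:E) =
      c%:E * \int[mu]_(x in `[0%R, 1%R]) (\1_A x : R)%:E)%E.
    by apply: ge0_integralZl_EFin => //; exact: mind.
  rewrite lee_wpmul2l// integral_indic// le_measure ?inE//; exact: measurableI.
have mZ (c : R) (A : set R) : 0 <= c -> measurable A ->
    measurable_fun (`[0%R, 1%R]%classic : set R) (fun x : R => c%:E * (\1_A x : R)%:E)%E.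
  by move=> c0 mA; apply: emeasurable_funM; [exact: measurable_cst|exact: (mind A _ mA)].
have pos (c : R) (A : set R) x : 0 <= c -> (0 <= c%:E * (\1_A x : R)%:E)%E.
  by move=> c0; rewrite mule_ge0 ?lee_fin.
have intD (F G : R -> \bar R) : (forall x, 0 <= F x)%E -> (forall x, 0 <= G x)%E ->
    measurable_fun (`[0%R, 1%R]%classic : set R) F ->
    measurable_fun (`[0%R, 1%R]%classic : set R) G ->
    (\int[mu]_(x in `[0%R, 1%R]) (F x + G x) =
     \int[mu]_(x in `[0%R, 1%R]) F x + \int[mu]_(x in `[0%R, 1%R]) G x)%E.
  by move=> *; apply: ge0_integralD.
rewrite intD; [|by move=> x; exact: pos|by move=> x; rewrite adde_ge0 ?pos|exact: mZ|
  by apply: emeasurable_funD; exact: mZ].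
rewrite intD; [|by move=> x; exact: pos|by move=> x; exact: pos|exact: mZ|exact: mZ].
apply: (le_trans (leeD (cM _ _ c10 mA1) (leeD (cM _ _ c20 mA2) (cM _ _ c30 mA3)))).
have fK (A : set R) : measurable A -> mu A = (fine (mu A))%:E.
  by move=> mA; rewrite fineK// fin_num_measure.
have A13 : fine (mu A1) <= 1 - fine (mu A3).
  rewrite -lee_fin EFinB -!fK// -probability_setC//.
  rewrite le_measure ?inE//; first exact: measurableC.
  move=> x; rewrite /A1 /A3 /= !in_itv/= andbT => xx0.
  by apply/negP; rewrite -ltNge (lt_le_trans xx0).
rewrite (fK A1)// (fK A2)// (fK A3)// -!EFinM -!EFinD lee_fin addrA !lerD2r.
exact: ler_wpM2l.
Qed.

Lemma sum_expR_geometric (R : realType) (a t : R) (K : nat) (F : nat -> R) :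
  0 < t -> 0 <= a -> (forall j, (j < K)%N -> F j <= a * expR (- (t * j.+1%:R))) ->
  \sum_(j < K) F j <= a * (expR (- t) / (1 - expR (- t))).
Proof.
move=> t0 a0 Fle.
apply: (@le_trans _ _ (a * \sum_(j < K) expR (- t) ^+ j.+1)).
  rewrite mulr_sumr; apply: ler_sum => j _.
  by rewrite -expRM_natr mulNr; exact: Fle.
rewrite ler_wpM2l// geometric_sum_le// expR_ge0 -[ltRHS]expR0 ltr_expR.
by rewrite oppr_lt0.
Qed.

Section FreshArm.
Context (R : realType) (phi D s d : R) (b K n0 N : nat) (thS thr : R).
Context (b0 : (0 < b)%N) (K0 : (0 < K)%N) (n0_gt0 : (0 < n0)%N).
Context (s0 : 0 < s) (d01 : 0 < d <= 1 / 3) (Ds : 0 <= D <= d * s ^+ 3 / 16).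
Context (phi_pi : phi <= pi).
Context (phase : forall j, (j < K)%N ->
  0 <= phi - D * htail R j 0 /\ s <= sin (phi - D * htail R j 0) / 2).

Let th := threshold phi D.
Let rej := rejects n0 thS b K th.
(** Crossings decay at rate [(1 - 2 * d) * D ^+ 2 / 2] per sample; giving up a further [d] leaves a
    convergent geometric series. *)
Let lam := (1 - 3 * d) * D ^+ 2 / 2.
Let n1 := (n0 + K * b)%N.
Let D0 : 0 <= D. Proof. by case/andP: Ds. Qed.
Let d0 : 0 < d. Proof. by case/andP: d01. Qed.

Lemma decay_rate_ge0 : 0 <= lam.
Proof.
rewrite /lam; apply: divr_ge0 => //; apply: mulr_ge0; last exact: sqr_ge0.
by case/andP: d01; lra.
Qed.

Let crossing_term (x : R) (j : nat) : R := expR (lam * (j.+1 * b)%:R) *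
  coin_mean x (j.+1 * b) (fun v => (crosses b th j v)%:R).

Definition crossing_cost (x : R) : R := \sum_(j < K) crossing_term x j.

(** Uniform in the mean of the arm, and uniform in the horizon as long as [b D^2] stays between two
    positive constants. *)
Lemma crossing_cost_le (x B1 B2 : R) : 0 <= x <= 1 -> 0 < B1 ->
  B1 <= b%:R * D ^+ 2 <= B2 ->
  crossing_cost x <= expR B2 / (1 - expR (- (d * B1 / 2))).
Proof.
move=> x01 B10 /andP[h1 h2].
have t0 : 0 < d * B1 / 2 by rewrite divr_gt0// mulr_gt0.
apply: le_trans (sum_expR_geometric (K := K) (F := crossing_term x) t0 (expR_ge0 B2) _) _.
  move=> j jK.
  have [p0 ps] := phase jK.
  have d1 : 0 < d <= 1 by case/andP: d01 => -> /=; lra.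
  have := coin_crosses_threshold_le x01 b0 s0 d1 Ds phi_pi p0 ps.
  move/(ler_wpM2l (expR_ge0 (lam * (j.+1 * b)%:R)))/le_trans; apply.
  rewrite -!expRD ler_expR /lam natrM.
  set m := b%:R * D ^+ 2 in h1 h2 *.
  have -> : (1 - 3 * d) * D ^+ 2 / 2 * (j.+1%:R * b%:R) = (1 - 3 * d) * m * j.+1%:R / 2.
    by rewrite /m; field.
  have J0 : 0 <= j.+1%:R :> R by [].
  have : d * B1 * j.+1%:R <= d * m * j.+1%:R.
    by rewrite ler_wpM2r// ler_wpM2l// ltW.
  by lra.
rewrite ler_wpM2l ?expR_ge0//.
have q1 : 0 < 1 - expR (- (d * B1 / 2)).
  by rewrite subr_gt0 -[ltRHS]expR0 ltr_expR oppr_lt0.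
rewrite -[leRHS]mul1r ler_wpM2r ?invr_ge0 ?(ltW q1)//.
by rewrite -[leRHS]expR0 ler_expR oppr_le0 ltW.
Qed.

(** An arm above the initial, largest threshold by [g] is dropped with probability exponentially
    small in [b]. A ratio of at most 1/5 makes the geometric series at most 1/4. *)
Lemma crossing_cost_good (x g : R) : 0 <= x <= 1 -> 0 < g <= 1 ->
  (1 - cos phi) / 2 + g <= x -> lam <= g ^+ 2 / 8 ->
  expR (- (b%:R * g ^+ 2 / 8)) <= 1 / 5 ->
  crossing_cost x <= 1 / 4.
Proof.
move=> x01 /andP[g0 g1] gx lg e5.
have B0 : 0 < b%:R :> R by rewrite ltr0n.
have t0 : 0 < b%:R * g ^+ 2 / 8 by rewrite divr_gt0// mulr_gt0// exprn_gt0.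
apply: le_trans (sum_expR_geometric (K := K) (F := crossing_term x) t0 ler01 _) _.
  move=> j jK; have [p0 ps] := phase jK.
  have th1 : th j.+1 <= (1 - cos phi) / 2.
    have -> : (1 - cos phi) / 2 = th 1%N.
      by rewrite /th /threshold /= htail_diag mulr0 subr0.
    exact: threshold_le.
  have g01 : 0 <= g <= 1 by rewrite ltW.
  have tail : coin_mean x (j.+1 * b) (fun v => (crosses b th j v)%:R) <=
      expR (- ((j.+1 * b)%:R * g ^+ 2 / 4)).
    apply: le_trans (coin_tail_le x01 (j.+1 * b) (t := th j.+1) g01 _); last by lra.
    apply: coin_mean_le => // v nv; rewrite ler_nat /crosses.
    by case: (all _ _) => //=; rewrite -nv take_size.
  apply: (le_trans (ler_wpM2l (expR_ge0 _) tail)).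
  rewrite mul1r -expRD ler_expR natrM.
  have J0 : 0 <= j.+1%:R * b%:R :> R by rewrite mulr_ge0.
  have := ler_wpM2r J0 lg.
  by lra.
set q := expR _ in e5 *; have q0 : 0 <= q := expR_ge0 _.
rewrite [leLHS]mul1r ler_pdivrMr; last by lra.
by lra.
Qed.

(** This is the renewal condition. Arms below [x0] are nearly always screened out, at cost close to
    1; arms in the window [[x0, y[] may cost up to about [1 + C1] but have little mass; arms above
    [y], of mass [eta], cost well below 1 and pay for all errors. *)
Lemma fresh_arm_le (mu : probability R R) (B1 B2 x0 y gs g0 g1 zeta : R) :
  let eta := fine (mu `[y, +oo[%classic) in
  let C1 := expR B2 / (1 - expR (- (d * B1 / 2))) in
  let sigma := expR (- (n0%:R * gs ^+ 2 / 4)) in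
  0 < B1 -> B1 <= b%:R * D ^+ 2 <= B2 ->
  x0 <= y -> 0 <= gs <= 1 -> x0 + gs <= thS -> thS + gs <= y ->
  0 < g0 <= 1 -> (1 - cos phi) / 2 + g0 <= y ->
  0 <= g1 <= 1 -> thr + g1 <= th K ->
  fine (mu `[x0, y[%classic) <= zeta * eta -> zeta * (1 + C1) <= 1 / 8 ->
  sigma * C1 <= eta / 8 -> sigma <= 1 / 8 ->
  expR (lam * n0%:R) <= 1 + eta / 8 ->
  expR (- ((K * b)%:R * g1 ^+ 2 / 4)) <= eta / 8 * expR (- (lam * N%:R)) ->
  lam <= g0 ^+ 2 / 8 -> expR (- (b%:R * g0 ^+ 2 / 8)) <= 1 / 5 ->
  forall k, (n1 <= k <= N)%N ->
  (\int[mu]_(x in `[0%R, 1%R]) (arm_bound rej thr lam n1 k [::] x)%:E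
     <= (expR (- (lam * (k%:R - n1%:R))))%:E)%E.
Proof.
move=> eta C1 sigma B10 hB xy gs01 xs sy g001 ygood g101 thrK win zC sC s8 eE passE lg e5 k /andP[nk kN].
have lam0 := decay_rate_ge0.
set dec := expR (- _); have dec0 : 0 < dec by exact: expR_gt0.
set E := expR (lam * n0%:R) in eE.
have E0 : 0 < E by exact: expR_gt0.
have E1 : 1 <= E by rewrite -[leLHS]expR0 ler_expR mulr_ge0.
have C10 : 0 <= C1.
  rewrite divr_ge0 ?expR_ge0// subr_ge0 -[leRHS]expR0 ler_expR oppr_le0.
  by rewrite divr_ge0// mulr_ge0// ltW.
have sg0 : 0 <= sigma := expR_ge0 _.
have eta0 : 0 <= eta by rewrite fine_ge0.
have eta1 : eta <= 1.
  have mA : measurable (`[y, +oo[%classic : set R) by exact: measurable_itv.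
  by rewrite /eta -lee_fin fineK ?fin_num_measure// probability_le1.
pose scr (v : seq bool) := thS * n0%:R <= (count id v)%:R.
have cc0 x : 0 <= x <= 1 -> 0 <= crossing_cost x.
  move=> x01; apply: sumr_ge0 => j _.
  by rewrite mulr_ge0 ?expR_ge0// coin_mean_ge0.
(* The term [eta / 8] covers an arm of mean below [thr] that survives all [K] tests. *)
have main x : 0 <= x <= 1 -> arm_bound rej thr lam n1 k [::] x <=
   dec * (eta / 8 + E * (coin_mean x n0 (fun v => (~~ scr v)%:R) +
     coin_mean x n0 (fun v => (scr v)%:R) * crossing_cost x)).
  move=> x01; rewrite mulrDr /arm_bound; apply: lerD; last first.
    by rewrite -/dec ler_wpM2l ?(ltW dec0)// mean_rej_cost_le.
  have [xthr|_] := ltP x thr; last first.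
    by rewrite mul0r mulr_ge0 ?(ltW dec0)// divr_ge0.
  rewrite /= mulr1n [leLHS]mul1r; apply: (le_trans (mean_kept_le thS th x01 n0_gt0 K0 nk)).
  apply: le_trans (coin_tail_ge x01 (K * b) (t := th K) g101 _) _.
    by move: xthr thrK; lra.
  apply: (le_trans passE); rewrite mulrC ler_wpM2r ?divr_ge0//.
  rewrite ler_expR lerN2 ler_wpM2l//.
  by rewrite lerBlDr ler_wpDr// ler_nat.
have pos x : 0 <= x <= 1 -> 0 <= arm_bound rej thr lam n1 k [::] x.
  move=> x01; rewrite /arm_bound addr_ge0 ?mulr_ge0 ?expR_ge0// ?coin_mean_ge0//.
  by move=> v; have [->|[t [_ -> _ _]]] := rej_costP lam rej [::] v; rewrite ?expR_ge0.
have scr01 (x : R) (P : pred (seq bool)) : 0 <= x <= 1 ->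
    0 <= coin_mean x n0 (fun v => (P v)%:R) <= 1.
  by move=> x01; rewrite coin_mean_ge0// coin_mean_le1.
have ccC x : 0 <= x <= 1 -> crossing_cost x <= C1 by move=> x01; exact: crossing_cost_le.
have C2 : 0 <= dec * (eta / 8 + E * (1 + C1)).
  by rewrite mulr_ge0 ?(ltW dec0)// addr_ge0 ?divr_ge0// mulr_ge0 ?(ltW E0)//; lra.
have C3 : 0 <= dec * (eta / 8 + E * (1 + sigma * C1)).
  rewrite mulr_ge0 ?(ltW dec0)// addr_ge0 ?divr_ge0// mulr_ge0 ?(ltW E0)//.
  by rewrite addr_ge0// mulr_ge0.
have C4 : 0 <= dec * (eta / 8 + E * (sigma + 1 / 4)).
  by rewrite mulr_ge0 ?(ltW dec0)// addr_ge0 ?divr_ge0// mulr_ge0 ?(ltW E0)//; lra.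
apply: le_trans (step_integral_le mu xy C3 C2 C4 pos _ _ _) _.
- move=> x x01 xx0; apply: (le_trans (main x x01)).
  rewrite ler_wpM2l ?(ltW dec0)// lerD2l ler_wpM2l ?(ltW E0)//.
  have /andP[f0 f1] := scr01 x (fun v => ~~ scr v) x01.
  have /andP[h0 h1] := scr01 x scr x01.
  apply: lerD => //; apply: (@le_trans _ _ (sigma * crossing_cost x)).
    rewrite ler_wpM2r ?cc0//; apply: coin_tail_ge => //; lra.
  by rewrite ler_wpM2l ?ccC.
- move=> x x01 _; apply: (le_trans (main x x01)).
  rewrite ler_wpM2l ?(ltW dec0)// lerD2l ler_wpM2l ?(ltW E0)//.
  have /andP[f0 f1] := scr01 x (fun v => ~~ scr v) x01.
  have /andP[h0 h1] := scr01 x scr x01.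
  apply: lerD => //; apply: le_trans (ccC x x01).
  by rewrite ler_piMl// cc0.
- move=> x x01 yx; apply: (le_trans (main x x01)).
  rewrite ler_wpM2l ?(ltW dec0)// lerD2l ler_wpM2l ?(ltW E0)//.
  have /andP[h0 h1] := scr01 x scr x01.
  apply: lerD.
    rewrite (eq_coin_mean x01 (g := fun v => ((count id v)%:R < thS * n0%:R)%R%:R)) //; last first.
      by move=> v _; rewrite /scr ltNge.
    by apply: coin_tail_le => //; lra.
  have : crossing_cost x <= 1 / 4 by apply: (@crossing_cost_good x g0) => //; lra.
  apply: le_trans; by rewrite ler_piMl// cc0.
rewrite lee_fin -/eta.
set m2 := fine (mu `[x0, y[%classic) in win *.
have m20 : 0 <= m2 by rewrite fine_ge0.
rewrite [leLHS](_ : _ = dec * ((eta / 8 + E * (1 + sigma * C1)) * (1 - eta) +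
  (eta / 8 + E * (1 + C1)) * m2 + (eta / 8 + E * (sigma + 1 / 4)) * eta)); last by ring.
rewrite -[leRHS]mulr1 ler_wpM2l ?(ltW dec0)//.
have m2C : (1 + C1) * m2 <= eta / 8.
  apply: (@le_trans _ _ ((1 + C1) * (zeta * eta))).
    by rewrite ler_wpM2l// addr_ge0.
  rewrite mulrA [(1 + C1) * _]mulrC.
  by have := ler_wpM2r eta0 zC; lra.
have m28 : m2 <= eta / 8.
  by apply: le_trans m2C; rewrite ler_peMl//; lra.
pose X := (1 + sigma * C1) * (1 - eta) + (1 + C1) * m2 + (sigma + 1 / 4) * eta.
(* Good arms cost at most 3/8 and so save [5 * eta / 8]; the screening leak and the window each cost
   at most [eta / 8]. The remaining [3 * eta / 8] absorbs the excess of [E] over 1 and the survival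
   term. *)
have XU : X <= 1 - 3 * eta / 8.
  have e1 : sigma * C1 * (1 - eta) <= eta / 8 * (1 - eta).
    by rewrite ler_wpM2r// subr_ge0.
  have e2 : sigma * eta <= 1 / 8 * eta by rewrite ler_wpM2r.
  have e3 : 0 <= eta * eta by rewrite mulr_ge0.
  by rewrite /X; lra.
have EX : E * X <= (1 + eta / 8) * (1 - 3 * eta / 8).
  apply: (@le_trans _ _ (E * (1 - 3 * eta / 8))); first by rewrite ler_wpM2l// ltW.
  by rewrite ler_wpM2r//; lra.
have e4 : eta * m2 <= eta * (eta / 8) by rewrite ler_wpM2l.
have e5' : 0 <= eta * eta by rewrite mulr_ge0.
by move: EX; rewrite /X; lra.
Qed.

End FreshArm.

(** * Asymptotics *)

Lemma expRN_le_inv (R : realType) (t : R) : 0 <= t -> expR (- t) <= (1 + t)^-1.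
Proof.
move=> t0; rewrite expRN lef_pV2 ?posrE ?expR_gt0//; first exact: expR_ge1Dx.
by rewrite ltr_pwDl.
Qed.

(** With [D = Delta / (1 + ln N)] the phase thus falls by at most [Delta] in total; this is the
    source of the factor [log^2 N] in the rate. *)
Lemma htail_le_ln (R : realType) (j N : nat) : (0 < N)%N -> (j <= N)%N ->
  htail R j 0 <= 1 + ln N%:R.
Proof.
move=> N0 jN.
have step k : (0 < k)%N -> htail R k 0 <= 1 + ln k%:R.
  elim: k => // -[_ _|k IH _].
    by rewrite htailS// htail_diag ln1 add0r addr0 invr1.
  rewrite htailS//; have := IH isT.
  have k2 : (k.+2%:R : R) != 0 by rewrite pnatr_eq0.
  have e : (k.+1%:R : R) = k.+2%:R * (1 + - k.+2%:R^-1).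
    by rewrite -[k.+2%:R]natr1 in k2 *; field.
  have lt1 : -1 < - k.+2%:R^-1 :> R by rewrite ltrN2 invf_lt1// ltr1n.
  have -> : ln (k.+1%:R : R) = ln k.+2%:R + ln (1 + - k.+2%:R^-1).
    have p1 : 0 < k.+2%:R :> R by rewrite ltr0n.
    have p2 : 0 < 1 + - k.+2%:R^-1 :> R by rewrite subr_gt0 invf_lt1// ltr1n.
    by rewrite e lnM ?posrE.
  have := le_ln1Dx lt1.
  set u := k.+2%:R^-1; set v := ln (1 - u); set w := ln _; lra.
case: j jN => [|j] jN.
  by rewrite htail_diag addr_ge0// ln_ge0// ler1n.
apply: le_trans (step _ _) _ => //.
by rewrite lerD2l ler_ln ?posrE ?ltr0n// ler_nat.
Qed.

(** The order [log^2 N] keeps [b D^2] between positive constants; the base of the logarithm is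
    immaterial. *)
Definition block_size (N : nat) : nat := (trunc_log 2 N ^ 2)%N.

(** All the tests of one arm take about a fraction [1 / q] of the horizon, the share lost by the
    renewal argument. *)
Definition block_count (q N : nat) : nat := (N %/ (q * block_size N))%N.

Section LargeN.
Context (R : realType) (N : nat).
Let L : R := ln N%:R.
Let l := trunc_log 2 N.

Lemma trunc_log_ln : 3 <= L -> L - 1 <= l%:R <= 2 * L.
Proof.
move=> L3.
have N0 : (0 < N)%N.
  rewrite lt0n; apply/eqP => N0; move: L3; rewrite /L N0 ln0//; lra.
have NR : 0 < N%:R :> R by rewrite ltr0n.
have /andP[h1 h2] := trunc_log_bounds (isT : 1 < 2)%N N0.
apply/andP; split.
  rewrite lerBlDr -ler_expR natr1 /L lnK ?posrE//.
  apply: (@le_trans _ _ (2 ^ l.+1)%:R); first by rewrite ler_nat ltnW.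
  rewrite natrX -[X in expR X]mulr1 expRM_natl lerXn2r ?nnegrE ?expR_ge0//.
  by have := expR_ge1Dx (1 : R); lra.
have -> : l%:R = 2 * (l%:R / 2) :> R by field.
rewrite ler_wpM2l// -ler_expR /L lnK ?posrE//.
apply: (@le_trans _ _ (2 ^ l)%:R); last by rewrite ler_nat.
rewrite natrX expRM_natl lerXn2r ?nnegrE ?expR_ge0//.
rewrite -[X in expR X]opprK expRN invf_ple ?posrE ?expR_gt0//.
by have := expR_ge1Dx (- 2^-1 : R); lra.
Qed.

Lemma cube_ln_le : 0 <= L -> (0 < N)%N -> L ^+ 3 <= 27 * N%:R.
Proof.
move=> L0 N0.
have -> : N%:R = expR (L / 3) ^+ 3 :> R.
  rewrite -expRM_natl (_ : 3%:R * (L / 3) = L); last by field.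
  by rewrite lnK// posrE ltr0n.
have -> : 27 * expR (L / 3) ^+ 3 = (3 * expR (L / 3)) ^+ 3 by ring.
rewrite lerXn2r ?nnegrE ?mulr_ge0 ?expR_ge0//.
by have := expR_ge1Dx (L / 3); lra.
Qed.

Lemma block_facts (q : nat) (Delta : R) : 3 <= L -> (0 < q)%N ->
  216 * q%:R <= L ->
  let b := block_size N in let K := block_count q N in let D := Delta / (1 + L) in
  [/\ (0 < b)%N, (0 < K)%N, L <= b%:R,
      Delta ^+ 2 / 4 <= b%:R * D ^+ 2 <= 4 * Delta ^+ 2 &
      N%:R / (2 * q%:R) <= (K * b)%:R :> R /\ (K * b)%:R <= N%:R / q%:R :> R].
Proof.
move=> L3 q0 Lq b K D.
have N0 : (0 < N)%N.
  rewrite lt0n; apply/eqP => N0; move: L3; rewrite /L N0 ln0//; lra.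
have NR : 0 < N%:R :> R by rewrite ltr0n.
have qR : 1 <= q%:R :> R by rewrite ler1n.
have /andP[l1 l2] := trunc_log_ln L3.
have bR : b%:R = l%:R ^+ 2 :> R by rewrite /b /block_size natrX.
have Lb : L <= b%:R by rewrite bR; nra.
have bL : b%:R <= 4 * L ^+ 2.
  rewrite bR (_ : 4 * L ^+ 2 = (2 * L) ^+ 2); last by ring.
  by rewrite lerXn2r ?nnegrE//; lra.
have b0 : (0 < b)%N by rewrite -(ltr_nat R); lra.
have b0R : 0 < b%:R :> R by rewrite ltr0n.
have L1 : 0 < 1 + L by lra.
have DE : b%:R * D ^+ 2 = Delta ^+ 2 * (l%:R / (1 + L)) ^+ 2.
  by rewrite bR /D; field; lra.
(* 216 = 8 * 27, where 27 comes from [cube_ln_le]. *)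
have NL : 8 * q%:R * L ^+ 2 <= N%:R.
  have := cube_ln_le (ltW (lt_le_trans _ L3)) N0; rewrite ltr0n => /(_ isT).
  have : 216 * q%:R * L ^+ 2 <= L * L ^+ 2 by rewrite ler_wpM2r// sqr_ge0.
  by rewrite -exprS; lra.
have qb0 : (0 < q * b)%N by rewrite muln_gt0 q0.
have KE : (N = K * (q * b) + N %% (q * b))%N by exact: divn_eq.
have Kup : (K * b)%:R <= N%:R / q%:R :> R.
  rewrite ler_pdivlMr; last by lra.
  by rewrite -natrM ler_nat -mulnA [(b * q)%N]mulnC leq_trunc_div.
have Klo : N%:R / (2 * q%:R) <= (K * b)%:R :> R.
  have lt : (N < K * (q * b) + q * b)%N by rewrite {1}KE ltn_add2l ltn_mod.
  have ltR : N%:R <= (K * b)%:R * q%:R + q%:R * b%:R :> R.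
    by rewrite -!natrM -natrD ler_nat -mulnA [(b * q)%N]mulnC ltnW.
  rewrite ler_pdivrMr; last by lra.
  have : q%:R * b%:R <= q%:R * (4 * L ^+ 2) by rewrite ler_wpM2l//; lra.
  by lra.
split=> //.
  rewrite lt0n; apply/eqP => K00; move: Klo; rewrite K00 mul0n leNgt divr_gt0//.
  by rewrite mulr_gt0//; lra.
rewrite DE; apply/andP; split.
  rewrite ler_wpM2l ?sqr_ge0// (_ : 4^-1 = (2^-1) ^+ 2 :> R); last by field.
  rewrite lerXn2r ?nnegrE ?divr_ge0 ?(ltW L1)// ler_pdivlMr//; lra.
rewrite mulrC ler_wpM2r ?sqr_ge0// (_ : 4 = 2 ^+ 2 :> R); last by ring.
rewrite lerXn2r ?nnegrE ?divr_ge0 ?(ltW L1)// ler_pdivrMr//; lra.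
Qed.

End LargeN.

Definition arm_rule (R : realType) (phi Delta thS : R) (n0 q N : nat) : pred (seq bool) :=
  rejects n0 thS (block_size N) (block_count q N) (threshold phi (Delta / (1 + ln N%:R))).

(** The slack [4 / q] covers two factors [1 - 2 / q]: one for replacing [1 + L] by [L], one for the
    [n1] samples lost. *)
Lemma rate_ge (R : realType) (L Delta Delta0 d Nr n1 q : R) :
  0 < L -> 0 < q -> 4 <= q -> q <= L -> 0 <= Nr -> 0 < d <= 1 / 3 ->
  n1 <= Nr * (2 / q) -> Delta0 ^+ 2 <= (1 - 3 * d - 4 / q) * Delta ^+ 2 ->
  Delta0 ^+ 2 / 2 * (Nr / L ^+ 2) <=
  (1 - 3 * d) * (Delta / (1 + L)) ^+ 2 / 2 * (Nr - n1).
Proof.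
move=> L0 q0 q4 qL N0 /andP[d0 d3] n1N hD.
pose u := 1 - 2 / q.
have iq : q * q^-1 = 1 by rewrite divff// gt_eqF.
have iq0 : 0 < q^-1 by rewrite invr_gt0.
have iq4 : q^-1 <= 4^-1 by rewrite lef_pV2 ?posrE.
have u0 : 0 <= u by rewrite /u; lra.
have Lu : (1 + L) ^+ 2 * u <= L ^+ 2.
  have : (1 + L) <= (1 + L) ^+ 2 * q^-1.
    rewrite expr2 -mulrA ler_peMr//; first by lra.
    by rewrite ler_pdivlMr//; lra.
  by rewrite /u; lra.
have Nu : Nr * u <= Nr - n1 by rewrite /u; lra.
have A0 : 0 < (1 + L) ^+ 2 by rewrite exprn_gt0//; lra.
have B0 : 0 < L ^+ 2 by rewrite exprn_gt0.
have d30 : 0 <= 1 - 3 * d by lra.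
have D20 : 0 <= Delta ^+ 2 by exact: sqr_ge0.
have hDu : Delta0 ^+ 2 <= (1 - 3 * d) * Delta ^+ 2 * (u * u).
  apply: (le_trans hD).
  have -> : (1 - 3 * d) * Delta ^+ 2 * (u * u) = ((1 - 3 * d) * (u * u)) * Delta ^+ 2 by ring.
  rewrite ler_wpM2r//.
  have : 0 <= d * q^-1 by rewrite mulr_ge0// ltW.
  have : 0 <= (1 - 3 * d) * (q^-1 * q^-1) by rewrite mulr_ge0// mulr_ge0// ltW.
  by rewrite /u; lra.
apply: (@le_trans _ _ ((1 - 3 * d) * (Delta / (1 + L)) ^+ 2 / 2 * (Nr * u))); last first.
  rewrite ler_wpM2l// divr_ge0// mulr_ge0// sqr_ge0//.
have -> : (1 - 3 * d) * (Delta / (1 + L)) ^+ 2 / 2 * (Nr * u) =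
   (1 - 3 * d) * Delta ^+ 2 * u * Nr / 2 / (1 + L) ^+ 2 by field; lra.
rewrite ler_pdivlMr//.
have -> : Delta0 ^+ 2 / 2 * (Nr / L ^+ 2) * (1 + L) ^+ 2 =
   Delta0 ^+ 2 * (1 + L) ^+ 2 * Nr / 2 / L ^+ 2 by field; lra.
rewrite ler_pdivrMr//.
have N2 : 0 <= Nr / 2 by rewrite divr_ge0.
have -> : Delta0 ^+ 2 * (1 + L) ^+ 2 * Nr / 2 = Delta0 ^+ 2 * (1 + L) ^+ 2 * (Nr / 2) by ring.
have -> : (1 - 3 * d) * Delta ^+ 2 * u * Nr / 2 * L ^+ 2 =
   (1 - 3 * d) * Delta ^+ 2 * u * L ^+ 2 * (Nr / 2) by ring.
rewrite ler_wpM2r//.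
apply: (le_trans (ler_wpM2r (ltW A0) hDu)).
have -> : (1 - 3 * d) * Delta ^+ 2 * (u * u) * (1 + L) ^+ 2 =
  (1 - 3 * d) * Delta ^+ 2 * u * ((1 + L) ^+ 2 * u) by ring.
by rewrite ler_wpM2l// mulr_ge0// mulr_ge0.
Qed.

(** With all parameters fixed, each condition of [fresh_arm_le] that involves [N] holds once [ln N]
    exceeds a constant. *)
Lemma prob_bad_arm_rule (R : realType) (mu : probability R R)
    (phi Delta Delta0 d s thS thr x0 y gs g0 g1 zeta : R) (n0 q : nat) :
  let eta := fine (mu `[y, +oo[%classic) in
  let C1 := expR (4 * Delta ^+ 2) / (1 - expR (- (d * (Delta ^+ 2 / 4) / 2))) in
  let sigma := expR (- (n0%:R * gs ^+ 2 / 4)) in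
  0 < Delta -> 0 < d <= 1 / 3 -> 0 < s -> phi <= pi ->
  (forall t, 0 <= t <= Delta -> 0 <= phi - t /\ s <= sin (phi - t) / 2) ->
  x0 <= y -> 0 <= gs <= 1 -> x0 + gs <= thS -> thS + gs <= y ->
  0 < g0 <= 1 -> (1 - cos phi) / 2 + g0 <= y ->
  0 < g1 <= 1 -> thr + g1 <= (1 - cos (phi - Delta)) / 2 ->
  0 < eta ->
  fine (mu `[x0, y[%classic) <= zeta * eta -> zeta * (1 + C1) <= 1 / 8 ->
  sigma * C1 <= eta / 8 -> sigma <= 1 / 8 -> (0 < n0)%N -> (3 < q)%N ->
  Delta0 ^+ 2 <= (1 - 3 * d - 4 / q%:R) * Delta ^+ 2 ->
  exists C : R, forall N : nat, C <= ln N%:R ->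
   (0 <= prob_bad mu (sequential_alg R (arm_rule phi Delta thS n0 q N)) N thr <=
    (expR (- (Delta0 ^+ 2 / 2 * (N%:R / (ln N%:R) ^+ 2))))%:E)%E.
Proof.
move=> eta C1 sigma Delta0p d01 s0 ppi phase xy gs01 xs sy g001 ygood g101 thrK eta0.
move=> win zC sC s8 n00 q4 hD.
case/andP: (d01) => d0 d3; case/andP: (g001) => g00 g0le; case/andP: (g101) => g10 g1le.
have q0 : (0 < q)%N by exact: leq_trans q4.
have qR : 4 <= q%:R :> R by rewrite (ler_nat _ 4).
pose kap := ln (1 + eta / 8).
have kap0 : 0 < kap by rewrite /kap ln_gt0// ltrDl divr_gt0.
pose lneta := `|ln (eta / 8)|.
pose c1 := 16 / (d * s ^+ 3); pose c2 := 8 / g0 ^+ 2; pose c3 := n0%:R / kap.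
pose c4 := 16 * q%:R / g1 ^+ 2.
have c10 : 0 <= c1 by rewrite divr_ge0// mulr_ge0// ?exprn_ge0// ltW.
have c20 : 0 <= c2 by rewrite divr_ge0 ?sqr_ge0.
have c30 : 0 <= c3 by rewrite divr_ge0// ltW.
have c40 : 0 <= c4 by apply: divr_ge0; [exact: mulr_ge0|exact: sqr_ge0].
have c50 : 0 <= lneta by exact: normr_ge0.
have c450 : 0 <= c4 * lneta by rewrite mulr_ge0.
have c60 : 0 <= n0%:R * q%:R :> R by rewrite mulr_ge0.
have Dc c : 0 <= c -> 0 <= Delta * c by move=> h; rewrite mulr_ge0// ltW.
have Dc1 := Dc _ c10; have Dc2 := Dc _ c20; have Dc3 := Dc _ c30; have Dc4 := Dc _ c40.
(* A sum of nonnegative requirements, so that [ln N] exceeds each of them. *)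
exists (3 + 216 * q%:R + Delta + Delta * c1 + Delta * c2 + Delta * c3 + Delta * c4
  + 4 * c2 + c4 * lneta + n0%:R * q%:R).
move=> N; set L := ln _ => CL.
have [L3 Lq LD] : [/\ 3 <= L, 216 * q%:R <= L & Delta <= L].
  by move: CL qR Delta0p Dc1 Dc2 Dc3 Dc4 c20 c450 c60; clear; split; lra.
have [L1c L2c L3c] : [/\ Delta * c1 <= L, Delta * c2 <= L & Delta * c3 <= L].
  by move: CL qR Delta0p Dc1 Dc2 Dc3 Dc4 c20 c450 c60; clear; split; lra.
have [L4c L5c] : Delta * c4 <= L /\ 4 * c2 <= L.
  by move: CL qR Delta0p Dc1 Dc2 Dc3 Dc4 c20 c450 c60; clear; split; lra.
have [L6c L7c] : c4 * lneta <= L /\ n0%:R * q%:R <= L.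
  by move: CL qR Delta0p Dc1 Dc2 Dc3 Dc4 c20 c450 c60; clear; split; lra.
clear CL Dc1 Dc2 Dc3 Dc4 c450 c60.
have [b0 K0 Lb DE [Klo Kup]] := @block_facts R N q Delta L3 q0 Lq.
set b := block_size N in b0 Lb DE Klo Kup *; set K := block_count q N in K0 Klo Kup *.
set D := Delta / (1 + L) in DE *.
have L1 : 0 < 1 + L by move: L3; clear; lra.
have N0 : (0 < N)%N.
  by rewrite lt0n; apply/eqP => N0; move: L3; rewrite /L N0 ln0// lern0.
have NR : 0 < N%:R :> R by rewrite ltr0n.
have LN : L <= N%:R by rewrite ltW// ln_sublinear.
have Dp : 0 <= D by rewrite divr_ge0 ?(ltW L1)// ltW.
have Dle c : 0 <= c -> Delta * c <= L -> D * c <= 1.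
  by move=> _ h; rewrite /D mulrAC ler_pdivrMr// mul1r; move: h; clear; lra.
have D1 : D <= 1 by rewrite -[leLHS]mulr1 Dle// mulr1.
have DD : D ^+ 2 <= D by rewrite expr2 ler_piMr.
set lam := (1 - 3 * d) * D ^+ 2 / 2.
have D20 : 0 <= D ^+ 2 by exact: sqr_ge0.
have lamD : lam <= D.
  have dD : 0 <= d * D ^+ 2 by rewrite mulr_ge0// ltW.
  by move: dD DD D20; rewrite /lam; clear; lra.
have lam0 : 0 <= lam by rewrite divr_ge0// mulr_ge0//; move: d3; clear; lra.
have Ds : 0 <= D <= d * s ^+ 3 / 16.
  have ds0 : 0 < d * s ^+ 3 by rewrite mulr_gt0 ?exprn_gt0.
  rewrite Dp /=; have := Dle c1 c10 L1c.
  by rewrite /c1 mulrA ler_pdivrMr// mul1r; clear; lra.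
have lg : lam <= g0 ^+ 2 / 8.
  apply: (le_trans lamD); have := Dle c2 c20 L2c.
  by rewrite /c2 mulrA ler_pdivrMr ?mul1r ?exprn_gt0//; clear; lra.
have lk : expR (lam * n0%:R) <= 1 + eta / 8.
  rewrite -[leRHS]lnK ?posrE ?ler_expR; last by rewrite addr_gt0// divr_gt0.
  have := Dle c3 c30 L3c; rewrite /c3.
  rewrite mulrA ler_pdivrMr// mul1r => h; apply: le_trans h.
  by rewrite ler_wpM2r.
have lg1 : lam * (16 * q%:R) <= g1 ^+ 2.
  have := Dle c4 c40 L4c; rewrite /c4.
  rewrite [D * _]mulrA ler_pdivrMr ?mul1r ?exprn_gt0//; apply: le_trans.
  by rewrite ler_wpM2r// mulr_ge0.
(* The exponent is at least twice [v * N]: one half pays for [lam * N], the other for the constant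
   [eta / 8]. *)
have passE : expR (- ((K * b)%:R * g1 ^+ 2 / 4)) <= eta / 8 * expR (- (lam * N%:R)).
  rewrite -[X in X * expR _]lnK ?posrE ?divr_gt0// -expRD ler_expR.
  have h1 : - lneta <= ln (eta / 8) by rewrite lerNl ler_normr lexx orbT.
  have q160 : 0 < 16 * q%:R :> R by rewrite mulr_gt0// ltr0n.
  pose v := g1 ^+ 2 / (16 * q%:R).
  have lv : lam * N%:R <= v * N%:R.
    by rewrite ler_wpM2r// /v ler_pdivlMr.
  have nv : lneta <= v * N%:R.
    rewrite /v mulrAC ler_pdivlMr//.
    have := le_trans L6c LN.
    by rewrite /c4 mulrAC ler_pdivrMr ?exprn_gt0//; clear; lra.
  have kv : 2 * (v * N%:R) <= (K * b)%:R * g1 ^+ 2 / 4.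
    have -> : 2 * (v * N%:R) = N%:R / (2 * q%:R) * (g1 ^+ 2 / 4).
      by rewrite /v; move: qR; clear; move=> qR; field; lra.
    by rewrite -[leRHS]mulrA ler_wpM2r// divr_ge0// sqr_ge0.
  by move: h1 lv nv kv; clear; lra.
have e5 : expR (- (b%:R * g0 ^+ 2 / 8)) <= 1 / 5.
  have t4 : 4 <= b%:R * g0 ^+ 2 / 8.
    have := le_trans L5c Lb.
    by rewrite /c2 mulrA ler_pdivrMr ?exprn_gt0//; clear; lra.
  have t0 : 0 <= b%:R * g0 ^+ 2 / 8 by apply: le_trans t4.
  apply: (le_trans (expRN_le_inv t0)).
  rewrite div1r; move: t4; set t := b%:R * _ / _; clear => t4.
  by rewrite lef_pV2 ?posrE; lra.
have hphase j : (j < K)%N -> 0 <= D * htail R j 0 <= Delta.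
  move=> jK; rewrite mulr_ge0 ?htail_ge0//=.
  have KN : (K <= N)%N by exact: leq_div.
  rewrite /D mulrAC ler_pdivrMr// ler_wpM2l ?(ltW Delta0p)//.
  by apply: htail_le_ln => //; exact: leq_trans (ltnW jK) KN.
have ph j : (j < K)%N ->
    0 <= phi - D * htail R j 0 /\ s <= sin (phi - D * htail R j 0) / 2.
  by move=> jK; apply: phase; exact: hphase.
have thK : thr + g1 <= threshold phi D K.
  apply: (le_trans thrK); rewrite /threshold.
  have K1 : (K.-1 < K)%N by rewrite prednK.
  have := hphase _ K1; set h := D * _ => hh.
  have [p0 _] : 0 <= phi - Delta /\ _ := phase Delta (ltac:(by rewrite lexx andbT ltW)).
  move: hh p0 ppi; clear => /andP[t0 t1] p0 ppi.
  rewrite ler_pM2r ?invr_gt0// lerD2l lerN2 leNgt.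
  by rewrite ltr_cos ?in_itv/=; [lra|apply/andP; split; lra|apply/andP; split; lra].
have B10 : 0 < Delta ^+ 2 / 4 by rewrite divr_gt0// exprn_gt0.
have g101' : 0 <= g1 <= 1 by rewrite ltW.
have fresh := @fresh_arm_le R phi D s d b K n0 N thS thr b0 K0 n00 s0 d01 Ds ppi ph
  mu _ _ x0 y gs g0 g1 zeta B10 DE xy gs01 xs sy g001 ygood g101' thK win zC sC s8 lk passE lg e5.
have /andP[p0 p1] := prob_bad_le lam0 fresh.
rewrite p0 /=; apply: (le_trans p1); rewrite lee_fin ler_expR lerN2.
have qR0 : 0 < q%:R :> R by rewrite ltr0n.
have n0q : n0%:R <= N%:R / q%:R :> R.
  by rewrite ler_pdivlMr//; exact: le_trans L7c LN.
apply: (@rate_ge _ L Delta Delta0 d N%:R _ q%:R) => //.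
- by move: L3; clear; lra.
- by move: Lq qR; clear; lra.
- by rewrite natrD; move: n0q Kup; clear; lra.
Qed.

(** * Mass of the reservoir near given levels *)

Section Mustar.
Context (R : realType) (mu : probability R R) (mu01 : reservoir mu) (mustar0 : 0 < mustar mu).

(** [fine] sends both infinities to 0, so positivity of [mustar mu] rules them out. *)
Lemma ess_sup_mustar : ess_sup mu (fun x : R => x%:E) = (mustar mu)%:E.
Proof.
by move: mustar0; rewrite /mustar; case: (ess_sup _ _) => [r||] //=; rewrite ltxx.
Qed.

Lemma mustar_le1 : mustar mu <= 1.
Proof.
rewrite -lee_fin -ess_sup_mustar; apply/ess_supP.
exists (~` `[0%R, 1%R]%classic); split.
- by apply: measurableC; exact: measurable_itv.
- rewrite [LHS]probability_setC; last exact: measurable_itv.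
  by rewrite [X in (_ - X)%E]mu01 subee.
- move=> x /= h; rewrite in_itv/= => /andP[_ x1]; apply: h.
  by rewrite lee_fin.
Qed.

Lemma mustar_mass (y : R) : y < mustar mu -> 0 < fine (mu `[y, +oo[%classic).
Proof.
move=> yM.
have my : measurable (`[y, +oo[%classic : set R) by exact: measurable_itv.
rewrite lt0r fine_ge0// andbT; apply/eqP => e0.
have : (ess_sup mu (fun x : R => x%:E) <= y%:E)%E.
  apply/ess_supP; exists (`[y, +oo[%classic); split => //.
    by rewrite -[LHS]fineK ?fin_num_measure// [fine _]e0.
  by move=> x /= /negP; rewrite lee_fin -ltNge in_itv/= andbT => /ltW.
by rewrite ess_sup_mustar lee_fin leNgt yM.
Qed.

(** The windows [[y - 1 / (n + 1), y[] decrease to the empty set; [y] is excluded, so an atom there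
    does no harm. *)
Lemma small_window (y e : R) : 0 < e ->
  exists x0, [/\ y - 1 <= x0, x0 < y & fine (mu `[x0, y[%classic) <= e].
Proof.
move=> e0.
pose F (n : nat) : set R := `[y - n.+1%:R^-1, y[%classic.
have mF n : measurable (F n) by exact: measurable_itv.
have F0 : \bigcap_n F n = set0.
  rewrite -subset0 => x /= Fx.
  have xy : x < y by have := Fx 0%N I; rewrite /F /= in_itv/= => /andP[].
  have [k hk] := ltr_add_invr xy.
  have := Fx k I; rewrite /F /= in_itv/= => /andP[+ _].
  by rewrite lerBlDr leNgt hk.
have : mu (F n) @[n --> \oo] --> mu (\bigcap_n F n).
  apply: nonincreasing_cvg_mu => //.
  - by rewrite (le_lt_trans (probability_le1 _ _))// ltry.
  - by rewrite F0; exact: measurable0.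
  - move=> n m nm; apply/subsetPset => x; rewrite /F /= !in_itv/= => /andP[h ->].
    rewrite andbT; apply: le_trans h; rewrite lerD2l lerN2.
    by rewrite lef_pV2 ?posrE ?ltr0n// ler_nat.
rewrite F0 measure0 => /fine_cvgP[_ /cvgrPdist_le /(_ e e0)[n _ /(_ n (leqnn n))]] /=.
rewrite sub0r normrN => h.
exists (y - n.+1%:R^-1); split.
- by rewrite lerD2l lerN2 invf_le1// ler1n.
- by rewrite ltrBlDr ltrDl invr_gt0.
- by apply: le_trans h; exact: ler_norm.
Qed.

End Mustar.

(** * Choice of the parameters *)

Lemma limn_esup_ge (R : realType) (u : nat -> \bar R) (c : \bar R) :
  (forall n, exists2 m, (n <= m)%N & (c <= u m)%E) -> (c <= limn_esup u)%E.
Proof.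
move=> h; rewrite limn_esup_lim; apply: lime_ge; first exact: is_cvg_esups.
apply: nearW => n; have [m nm cm] := h n; apply: (le_trans cm).
by apply: ereal_sup_ubound; exists m.
Qed.

(** On [[0, pi]] one has [sin >= sin^2 = (1 - cos) * (1 + cos)], and monotonicity of the cosine
    bounds each factor at one end of the range. *)
Lemma sin_ge_on (R : realType) (phi Delta : R) : 0 < phi - Delta -> phi < pi ->
  0 <= Delta ->
  exists2 s : R, 0 < s & forall t, 0 <= t <= Delta ->
    0 <= phi - t /\ s <= sin (phi - t) / 2.
Proof.
move=> p0 ppi D0.
have cle a c : 0 <= a -> a <= c -> c <= pi -> cos c <= cos a :> R.
  move=> a0 ac cpi; rewrite leNgt ltr_cos ?in_itv/= -?leNgt//;
    by apply/andP; split; lra.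
have c1 : -1 < cos phi.
  rewrite -cospi ltr_cos ?in_itv/= ?lexx ?pi_ge0//; apply/andP; split; lra.
have c2 : cos (phi - Delta) < 1.
  rewrite -cos0 ltr_cos ?in_itv/= ?lexx ?pi_ge0//; apply/andP; split; lra.
exists ((1 - cos (phi - Delta)) * (1 + cos phi) / 2).
  by rewrite divr_gt0// mulr_gt0//; lra.
move=> t /andP[t0 tD]; split; first by lra.
rewrite ler_pM2r//.
have s0 : 0 <= sin (phi - t) by apply: sin_ge0_pi; apply/andP; split; lra.
have s1 := sin_le1 (phi - t).
apply: (@le_trans _ _ (sin (phi - t) ^+ 2)); last by rewrite expr2 ler_piMr.
rewrite sin2cos2.
have h1 : cos phi <= cos (phi - t) by apply: cle; lra.
have h2 : cos (phi - t) <= cos (phi - Delta) by apply: cle; lra.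
have -> : 1 - cos (phi - t) ^+ 2 = (1 - cos (phi - t)) * (1 + cos (phi - t)) by ring.
by apply: ler_pM; lra.
Qed.

Lemma neglog_ge (R : realType) (p : \bar R) (Z a : R) : 0 < a ->
  (0 <= p <= (expR (- Z))%:E)%E -> ((Z * a)%:E <= neglog p * a%:E)%E.
Proof.
move=> a0 /andP[p0 pZ]; rewrite /neglog; case: eqP => [_|/eqP pn0].
  by rewrite gt0_mulye ?lte_fin// leey.
case: p p0 pZ pn0 => [r|//|//]; rewrite !lee_fin => r0 rZ rn0 /=.
have r0' : 0 < r by rewrite lt_def r0 andbT; move: rn0; rewrite eqe.
rewrite ler_wpM2r ?(ltW a0)// lerNr -[leRHS]expRK.
by rewrite ler_ln ?posrE// expR_gt0.
Qed.

Section Phases.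
Context (R : realType).

(** The coordinate in which [c_const] is half a squared distance; on means in [[0, 1]] it inverts
    [(1 - cos phi) / 2]. *)
Definition phase_of (a : R) : R := acos (1 - 2 * a).

Lemma cos_phase a : 0 <= a <= 1 -> cos (phase_of a) = 1 - 2 * a.
Proof.
move=> /andP[a0 a1]; apply: acosK; rewrite in_itv/=.
by apply/andP; split; lra.
Qed.

Lemma phase_bounds a : 0 <= a <= 1 -> 0 <= phase_of a <= pi.
Proof.
move=> /andP[a0 a1].
have h : -1 <= 1 - 2 * a <= 1 by apply/andP; split; lra.
by rewrite acos_ge0 ?acos_lepi.
Qed.

Lemma phase_lt a c : 0 <= a -> a < c -> c <= 1 -> phase_of a < phase_of c.
Proof.
move=> a0 ac c1.
have a01 : 0 <= a <= 1 by apply/andP; split; lra.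
have c01 : 0 <= c <= 1 by apply/andP; split; lra.
by rewrite -ltr_cos ?in_itv/= ?phase_bounds// !cos_phase//; lra.
Qed.

(** The threshold starts slightly below [M] and falls by slightly more than the phase distance from
    [M] to [M - eps]; since [eps < eps1] it still ends above [M - eps1]. Rational values keep the
    parameters countable. *)
Lemma exists_phases (M eps eps1 : R) : 0 < eps -> eps < eps1 -> eps < M <= 1 ->
  exists rphi rD : rat, let phi := ratr rphi : R in let Delta := ratr rD in
  [/\ 0 <= phase_of M - phase_of (M - eps) < Delta, 0 < phi - Delta, phi < pi,
      (1 - cos phi) / 2 < M &
      exists2 g, 0 < g <= 1 & M - eps1 + g <= (1 - cos (phi - Delta)) / 2].
Proof.
move=> eps0 eps01 /andP[epsM M1].
(* [M - eps1] may be negative, where [acos] is meaningless. *)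
pose thr := Num.max (M - eps1) 0.
have thr0 : 0 <= thr by rewrite /thr le_max lexx orbT.
have thr_ge : M - eps1 <= thr by rewrite /thr le_max lexx.
have thr_lt : thr < M - eps by rewrite /thr gt_max; apply/andP; split; lra.
clearbody thr.
have pe : phase_of (M - eps) < phase_of M by apply: phase_lt; lra.
have p1 : phase_of thr < phase_of (M - eps) by apply: phase_lt; lra.
have t01 : 0 <= thr <= 1 by apply/andP; split; lra.
have M01 : 0 <= M <= 1 by apply/andP; split; lra.
have /andP[pt0 ptpi] := phase_bounds t01; have /andP[pM0 pMpi] := phase_bounds M01.
have [rD] : exists q, ratr q \in
    `](phase_of M - phase_of (M - eps)), (phase_of M - phase_of thr)[.
  by apply: rat_in_itvoo; lra.
rewrite in_itv/= => /andP[hD1 hD2].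
have [rphi] : exists q, ratr q \in `](phase_of thr + ratr rD), (phase_of M)[.
  by apply: rat_in_itvoo; lra.
rewrite in_itv/= => /andP[hp1 hp2].
exists rphi, rD; move: hD1 hD2 hp1 hp2.
set phi := ratr rphi; set Delta := ratr rD => hD1 hD2 hp1 hp2 /=.
split; [by apply/andP; split; lra|by lra|by lra| |].
  have : cos (phase_of M) < cos phi.
    by rewrite ltr_cos ?in_itv/= ?phase_bounds//; apply/andP; split; lra.
  by rewrite cos_phase//; lra.
have clt : cos (phi - Delta) < cos (phase_of thr).
  by rewrite ltr_cos ?in_itv/= ?phase_bounds//; [lra|apply/andP; split; lra].
have cge := cos_geN1 (phi - Delta).
move: clt; rewrite cos_phase// => clt.
exists ((1 - cos (phi - Delta)) / 2 - thr); first by apply/andP; split; lra.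
by lra.
Qed.

End Phases.

Lemma exists_rate (R : realType) (Delta Delta0 : R) : 0 <= Delta0 < Delta ->
  exists (d : R) (q : nat), [/\ 0 < d <= 1 / 3, (3 < q)%N &
    Delta0 ^+ 2 <= (1 - 3 * d - 4 / q%:R) * Delta ^+ 2].
Proof.
move=> /andP[Delta00 lt].
have Dp : 0 < Delta by exact: le_lt_trans lt.
have D2 : 0 < Delta ^+ 2 by rewrite exprn_gt0.
pose rho := Delta0 ^+ 2 / Delta ^+ 2.
have e : Delta0 ^+ 2 = rho * Delta ^+ 2 by rewrite /rho divfK// gt_eqF.
have rho1 : rho < 1.
  by rewrite /rho ltr_pdivrMr// mul1r ltrXn2r ?nnegrE// ltW.
have rho0 : 0 <= rho by rewrite divr_ge0// sqr_ge0.
have r10 : 0 < 1 - rho by rewrite subr_gt0.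
(* The slack [1 - rho] is shared equally between [3 * d] and [4 / q]. *)
exists ((1 - rho) / 6), (Num.truncn (8 / (1 - rho)) + 4)%N.
rewrite e; clearbody rho; clear e lt Delta00 Dp.
split; [by apply/andP; split; lra|by rewrite addnS ltnS leq_addl|].
set q := (_ + 4)%N.
have qlt : 8 / (1 - rho) < q%:R.
  by apply: (lt_le_trans (truncnS_gt _)); rewrite ler_nat /q -addn1 leq_add2l.
have q0 : 0 < q%:R :> R by rewrite ltr0n /q addnS.
have qr : 4 / q%:R <= (1 - rho) / 2.
  by move: qlt; rewrite ltr_pdivrMr// ler_pdivrMr//; lra.
by rewrite ler_wpM2r ?(ltW D2)//; lra.
Qed.

Lemma exists_expRN_le (R : realType) (c tau : R) : 0 < c -> 0 < tau ->
  exists2 n, (0 < n)%N & expR (- (n%:R * c)) <= tau.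
Proof.
move=> c0 tau0; pose t := (tau * c)^-1.
exists (Num.truncn t).+1 => //.
have nt : t <= (Num.truncn t).+1%:R by rewrite ltW// truncnS_gt.
have h : tau^-1 <= (Num.truncn t).+1%:R * c.
  apply: le_trans (ler_wpM2r (ltW c0) nt).
  by rewrite /t invfM -mulrA mulVf ?mulr1// gt_eqF.
set z := _ * _ in h *.
have z0 : 0 <= z by apply: le_trans h; rewrite invr_ge0 ltW.
apply: (le_trans (expRN_le_inv z0)).
rewrite -[leRHS]invrK lef_pV2 ?posrE ?invr_gt0//; last by rewrite ltr_pwDl.
by apply: (le_trans h); rewrite lerDr.
Qed.

(** The order of choice avoids circularity: [C1] depends only on [d] and [Delta], the window is then
    taken small against [C1] and [eta], and [n0] comes last. Only [phi], [Delta], [thS], [n0] and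
    [q] enter the rule; the rest belongs to the analysis. *)
Lemma exists_arm_rule (R : realType) (mu : probability R R) (eps eps1 : R) :
  0 < eps -> eps < eps1 -> reservoir mu -> eps < mustar mu ->
  exists (rphi rD rS : rat) (n0 q : nat) (C : R), forall N : nat, C <= ln N%:R ->
   (0 <= prob_bad mu (sequential_alg R
          (arm_rule (ratr rphi : R) (ratr rD) (ratr rS) n0 q N)) N (mustar mu - eps1) <=
    (expR (- (c_const (mustar mu) (mustar mu - eps) * (N%:R / (ln N%:R) ^+ 2))))%:E)%E.
Proof.
move=> eps0 eps01 mu01 epsM.
have M0 : 0 < mustar mu by exact: lt_trans epsM.
have epsM1 : eps < mustar mu <= 1 by rewrite epsM mustar_le1.
have [rphi [rD /=]] := exists_phases eps0 eps01 epsM1.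
set phi := ratr rphi; set Delta := ratr rD; set M := mustar mu.
set Delta0 := phase_of M - _ => -[D01 pD0 phpi th0M [g1 g101 thrK]].
have Dp : 0 < Delta by case/andP: D01 => h; exact: le_lt_trans.
have [s s0 hs] := sin_ge_on pD0 phpi (ltW Dp).
have [d [q [d01 q4 hD]]] := exists_rate D01.
set th0 := (1 - cos phi) / 2 in th0M.
have th00 : 0 <= th0 by rewrite divr_ge0// subr_ge0 cos_le1.
(* Halfway between the initial threshold and [M]: such arms exceed every threshold by a fixed gap
   and still have positive mass. *)
pose y := (th0 + M) / 2.
have yM : y < M by rewrite /y; move: th0M; clear; lra.
have g001 : 0 < y - th0 <= 1.
  have M1 : M <= 1 by case/andP: epsM1.
  by rewrite /y; move: th0M th00 M1; clear => *; apply/andP; split; lra.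
have eta0 : 0 < fine (mu `[y, +oo[%classic) by exact: mustar_mass.
set eta := fine _ in eta0.
pose C1 := expR (4 * Delta ^+ 2) / (1 - expR (- (d * (Delta ^+ 2 / 4) / 2))).
have C10 : 0 <= C1.
  case/andP: d01 => d0 _.
  rewrite divr_ge0 ?expR_ge0// subr_ge0 -[leRHS]expR0 ler_expR oppr_le0.
  by rewrite !divr_ge0// mulr_ge0 ?(ltW d0)// divr_ge0// sqr_ge0.
pose zeta := (8 * (1 + C1))^-1.
have C11 : 0 < 1 + C1 by rewrite ltr_pwDl.
have zeta0 : 0 < zeta by rewrite invr_gt0 mulr_gt0.
have zC : zeta * (1 + C1) <= 1 / 8.
  by rewrite /zeta invfM -mulrA mulVf ?gt_eqF// mulr1 div1r.
have [x0 [x0lo x0y win]] := small_window mu y (mulr_gt0 zeta0 eta0).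
have [rS] := rat_in_itvoo x0y.
set thS := ratr rS; rewrite in_itv/= => /andP[hS1 hS2].
pose gs := Num.min (thS - x0) (y - thS).
have gs0 : 0 < gs by rewrite /gs lt_min !subr_gt0 hS1.
have gsl : gs <= thS - x0 by rewrite /gs ge_min lexx.
have gsr : gs <= y - thS by rewrite /gs ge_min lexx orbT.
have [xs sy gs1] : [/\ x0 + gs <= thS, thS + gs <= y & gs <= 1].
  by move: gsl gsr x0lo gs0 hS1; clear => *; split; lra.
have gs01 : 0 <= gs <= 1 by rewrite ltW.
have gs20 : 0 < gs ^+ 2 / 4 by rewrite divr_gt0// exprn_gt0.
have tau0 : 0 < Num.min (1 / 8) (eta * zeta) by rewrite lt_min divr_gt0// mulr_gt0.
have [n0 n00] := exists_expRN_le gs20 tau0.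
rewrite mulrA le_min => /andP[s8 sz].
have sC : expR (- (n0%:R * gs ^+ 2 / 4)) * C1 <= eta / 8.
  apply: (le_trans (ler_wpM2r C10 sz)); rewrite -mulrA ler_wpM2l ?(ltW eta0)//.
  apply: (@le_trans _ _ (zeta * (1 + C1))); last by rewrite -div1r.
  by rewrite ler_wpM2l ?(ltW zeta0)// lerDr.
have ygood : th0 + (y - th0) <= y by rewrite addrC subrK.
have [C hC] := @prob_bad_arm_rule R mu phi Delta Delta0 d s thS (M - eps1) x0 y gs
  (y - th0) g1 zeta n0 q
  Dp d01 s0 (ltW phpi) hs (ltW x0y) gs01 xs sy g001 ygood g101 thrK eta0 win zC sC s8
  n00 q4 hD.
by exists rphi, rD, rS, n0, q, C.
Qed.

Theorem theorem1p11 (R : realType) (eps eps1 : R) :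
  0 < eps -> eps < eps1 -> eps1 < 1 ->
  exists A : nat -> algorithm R,
    (forall N, valid_algorithm (A N)) /\
    forall mu : probability R R, reservoir mu -> eps < mustar mu ->
      ((c_const (mustar mu) (mustar mu - eps))%:E <=
       limn_esup (fun N : nat =>
         (neglog (prob_bad mu (A N) N (mustar mu - eps1)) *
          ((ln N%:R) ^+ 2 / N%:R)%:E)%E))%E.
Proof.
move=> eps0 eps_lt _.
pose rule (N : nat) : pred (seq bool) :=
  if unpickle (logn 2 N) is Some (phi, Delta, thS, n0, q) then
    arm_rule (ratr phi : R) (ratr Delta) (ratr thS) n0 q N
  else xpred0.
exists (fun N => sequential_alg R (rule N)).
split=> [N|mu mu01 epsM]; first exact: sequential_alg_valid.
have [phi [Delta [thS [n0 [q [C hC]]]]]] := exists_arm_rule eps0 eps_lt mu01 epsM.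
apply: limn_esup_ge => n.
pose a := pickle (phi, Delta, thS, n0, q).
(* An odd multiple of [2 ^ a] has valuation exactly [a]; [m] makes it at least [n] and 2, with
   [C <= ln N]. *)
pose m := maxn n (maxn 2 (Num.truncn (expR C)).+1).
pose N := (2 ^ a * (2 * m).+1)%N.
have mN : (m <= N)%N.
  apply: (@leq_trans (2 * m).+1); last by rewrite leq_pmull// expn_gt0.
  by rewrite ltnW// ltnS leq_pmull.
exists N; first by apply: leq_trans mN; rewrite /m leq_maxl.
have N2 : (2 <= N)%N by apply: leq_trans mN; rewrite /m !leq_max /= orbT.
have ruleE : rule N = arm_rule (ratr phi : R) (ratr Delta) (ratr thS) n0 q N.
  rewrite /rule /N lognM ?expn_gt0// pfactorK// logn_coprime ?addn0 ?pickleK//.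
  by rewrite coprime2n /= oddM.
have NR : 1 < N%:R :> R by rewrite ltr1n.
have NR0 : 0 < N%:R :> R by exact: lt_trans NR.
have L0 : 0 < ln N%:R :> R by rewrite ln_gt0.
have CN : C <= ln N%:R.
  rewrite -ler_expR lnK ?posrE//.
  apply: (le_trans (ltW (truncnS_gt (expR C)))); rewrite ler_nat.
  by apply: leq_trans mN; rewrite /m !leq_max leqnn !orbT.
rewrite ruleE.
have a0 : 0 < (ln N%:R) ^+ 2 / N%:R :> R by rewrite divr_gt0 ?exprn_gt0.
apply: le_trans (neglog_ge a0 (hC N CN)).
rewrite lee_fin -mulrA [X in _ * X](_ : _ = 1) ?mulr1//.
by field; rewrite !gt_eqF.
Qed.
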